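(* There exists an absolute constant $C>0$ for which the following holds. Let $\lambda>0$, let $E$ be a Banach space with modulus of convexity of power type $2$ with constant $\lambda$, and let $B_E$ be its unit ball. Then, for every integer $m\ge 2$ and all vectors $X_1,\ldots,X_m$ in the dual space $E^*$, $$ \mathbb{E}\sup_{y\in B_E}\left|\sum_{j=1}^m \varepsilon_j |\langle X_j,y\rangle|^2\right| \le C\,\lambda^4\,T_2(E^* )\,\sqrt{\log m}\;\max_{1\le j\le m}\|X_j\|_*\;\sup_{y\in B_E}\left(\sum_{j=1}^m |\langle X_j,y\rangle|^2\right)^{1/2}, $$ where the expectation is taken over i.i.d. Bernoulli random variables $\varepsilon_1,\ldots,\varepsilon_m$ (independent, symmetric, with values $\pm1$) and $T_2(E^* )$ is the type $2$ constant of $E^*$.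
   Context: A Banach space $E$ has modulus of convexity of power type $2$ with constant $\lambda$ if for all $x,y\in E$, $$\left\|\frac{x+y}{2}\right\|^2+\lambda^{-2}\left\|\frac{x-y}{2}\right\|^2\le\frac12\left(\|x\|^2+\|y\|^2\right).$$ $E^*$ is the dual of $E$, $\|\cdot\|_*$ is the dual norm, and $\langle X,y\rangle$ denotes the duality pairing of $X\in E^*$ with $y\in E$. A Banach space $F$ has type $2$ if there is a constant $C'$ such that for every $N$ and all $x_1,\ldots,x_N\in F$, $\mathbb{E}\|\sum_{i=1}^N g_i x_i\|\le C'\left(\sum_{i=1}^N\|x_i\|^2\right)^{1/2}$, where $g_1,\ldots,g_N$ are independent standard Gaussian variables; the smallest such $C'$ is the type $2$ constant $T_2(F)$. If $E$ has modulus of convexity of power type $2$, then $E^*$ has type $2$, so $T_2(E^* )<\infty$. *)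

(* Defs.v *)
From HB Require Import structures.
From mathcomp Require Import all_boot all_order all_algebra.
From mathcomp Require Import all_classical all_reals all_analysis.

Set Implicit Arguments.
Unset Strict Implicit.
Unset Printing Implicit Defensive.

Import Order.TTheory GRing.Theory Num.Theory.
Import numFieldNormedType.Exports.

Local Open Scope classical_set_scope.
Local Open Scope ring_scope.

Section unit_ball.
Context {R : realType}.

Definition unit_ball (E : normedModType R) : set E := [set y | `|y| <= 1].

Definition convex_power_type2 (E : normedModType R) (lambda : R) : Prop :=
  forall x y : E,
    `|2^-1 *: (x + y)| ^+ 2 + lambda ^- 2 * `|2^-1 *: (x - y)| ^+ 2
      <= 2^-1 * (`|x| ^+ 2 + `|y| ^+ 2).

End unit_ball.
Arguments unit_ball {R} E.

Section dual.
Context {R : realType} (E : normedModType R).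

Definition functional : {pred E -> R^o} :=
  fun f => `[< linear f /\ continuous f >].

Lemma functionalP (f : E -> R^o) :
  reflect (linear f /\ continuous f) (f \in functional).
Proof. exact: asboolP. Qed.

Lemma functional_submod_closed : submod_closed functional.
Proof.
split.
  apply/functionalP; split=> [a x y|]; last exact: cst_continuous.
  by rewrite -[LHS]/(0 : R^o) -[RHS]/(a *: (0 : R^o) + 0) scaler0 addr0.
move=> a f g /functionalP[lf cf] /functionalP[lg cg].
apply/functionalP; split=> [b x y|x].
  rewrite -[LHS]/(a *: f (b *: x + y) + g (b *: x + y)).
  rewrite -[RHS]/(b *: (a *: f x + g x) + (a *: f y + g y)).
  by rewrite lf lg !scalerDr addrACA !scalerA mulrC.
apply: (@continuousD _ _ _ (a *: f) g); last exact: cg.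
by apply: continuousZl_tmp; exact: cf.
Qed.

HB.instance Definition _ :=
  GRing.isSubmodClosed.Build _ _ functional functional_submod_closed.

(* The coercion to functions is the duality pairing: <X, y> is written X y. *)
Record dual : Type := Dual { pairing :> E -> R^o ; _ : pairing \in functional }.

HB.instance Definition _ := [isSub for pairing].
HB.instance Definition _ := [Choice of dual by <:].
HB.instance Definition _ := [SubChoice_isSubLmodule of dual by <:].

Definition dual_norm (X : dual) : R :=
  sup [set `|X y : R| | y in unit_ball E].

Lemma dual_linear (X : dual) : linear X.
Proof. by have /functionalP[] := valP X. Qed.

Lemma dual_continuous (X : dual) : continuous X.
Proof. by have /functionalP[] := valP X. Qed.

HB.instance Definition _ (X : dual) :=
  GRing.isLinear.Build R E R^o _ (pairing X) (dual_linear X).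

Lemma dualD (X Y : dual) y : (X + Y) y = X y + Y y. Proof. by []. Qed.

Lemma dualZ (a : R) (X : dual) y : (a *: X) y = a * X y. Proof. by []. Qed.

Lemma dual_norm_has_sup (X : dual) :
  has_sup [set `|X y : R| | y in unit_ball E].
Proof.
split; first by exists `|X 0|; exists 0 => //=; rewrite /unit_ball/= normr0.
have /bounded_funP/(_ 1)[M XM] : bounded_near (pairing X) (nbhs (0 : E)).
  by apply/linear_bounded_continuous; exact: dual_continuous.
by exists M => _ [y y1 <-]; exact: XM.
Qed.

Lemma dual_normP (X : dual) y : `|X y : R| <= dual_norm X * `|y|.
Proof.
have [->|y0] := eqVneq y 0; first by rewrite linear0 !normr0 mulr0.
rewrite -ler_pdivrMr ?normr_gt0//.
have -> : `|X y : R| / `|y| = `|X (`|y|^-1 *: y) : R|.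
  by rewrite linearZ/= normrM normfV normr_id mulrC.
apply: sup_upper_bound; first exact: dual_norm_has_sup.
exists (`|y|^-1 *: y) => //; rewrite /unit_ball/= normrZ normfV normr_id.
by rewrite mulVf// normr_eq0.
Qed.

Lemma dual_norm_le (X : dual) (M : R) :
  (forall y, unit_ball E y -> `|X y : R| <= M) -> dual_norm X <= M.
Proof.
move=> XM; apply: ge_sup; first by case: (dual_norm_has_sup X).
by move=> _ [y y1 <-]; exact: XM.
Qed.

Lemma dual_norm_ub (X : dual) y : unit_ball E y -> `|X y : R| <= dual_norm X.
Proof.
by move=> y1; apply: sup_upper_bound; [exact: dual_norm_has_sup|exists y].
Qed.

Lemma dual_normD (X Y : dual) :
  dual_norm (X + Y) <= dual_norm X + dual_norm Y.
Proof.
apply: dual_norm_le => y y1; rewrite dualD.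
by rewrite (le_trans (ler_normD _ _))// lerD// dual_norm_ub.
Qed.

Lemma dual_normZ (a : R) (X : dual) : dual_norm (a *: X) = `|a| * dual_norm X.
Proof.
have leZ b (Y : dual) : dual_norm (b *: Y) <= `|b| * dual_norm Y.
  apply: dual_norm_le => y y1; rewrite dualZ normrM.
  by rewrite ler_wpM2l// dual_norm_ub.
apply/eqP; rewrite eq_le leZ/=; have [->|a0] := eqVneq a 0.
  rewrite normr0 mul0r; apply: le_trans (normr_ge0 ((0 *: X : dual) 0 : R)) _.
  by apply: dual_norm_ub; rewrite /unit_ball/= normr0.
have := leZ a^-1 (a *: X); rewrite scalerA mulVf// scale1r normfV.
by rewrite ler_pdivlMl ?normr_gt0.
Qed.

Lemma dual_norm0_eq0 (X : dual) : dual_norm X = 0 -> X = 0.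
Proof.
move=> X0; apply/val_inj/funext => y /=; apply/eqP; rewrite -normr_le0.
by rewrite (le_trans (dual_normP X y))// X0 mul0r.
Qed.

HB.instance Definition _ :=
  Lmodule_isNormed.Build R dual dual_normD dual_normZ dual_norm0_eq0.

End dual.

Section probability.
Context {R : realType} {d : measure_display} {T : measurableType d}.
Local Open Scope ereal_scope.

Definition independent_RV (P : probability T R) (n : nat)
    (X : 'I_n -> {RV P >-> R}) : Prop :=
  forall A : 'I_n -> set R, (forall i, measurable (A i)) ->
    P (\bigcap_(i in [set: 'I_n]) (X i @^-1` A i)) =
    \prod_(i < n) P (X i @^-1` A i).

Definition standard_gaussian (P : probability T R) (X : {RV P >-> R}) : Prop :=
  forall A : set R, measurable A -> distribution P X A = normal_prob 0 1 A.

Definition symmetric_bernoulli (P : probability T R) (X : {RV P >-> R}) : Prop :=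
  distribution P X [set 1%R] = (2^-1)%:E /\
  distribution P X [set (-1)%R] = (2^-1)%:E.

End probability.

Section type2.
Context {R : realType}.
Local Open Scope ereal_scope.

Definition has_type2_with (F : normedModType R) (C : R) : Prop :=
  forall (N : nat) (x : 'I_N -> F)
    (d : measure_display) (T : measurableType d) (P : probability T R)
    (g : 'I_N -> {RV P >-> R}),
  independent_RV g -> (forall i, standard_gaussian (g i)) ->
  'E_P[fun w => `|\sum_(i < N) g i w *: x i|%R] <=
  (C * Num.sqrt (\sum_(i < N) `|x i| ^+ 2))%:E.

(* Equal to +oo when F does not have type 2. *)
Definition type2_constant (F : normedModType R) : \bar R :=
  ereal_inf [set C%:E | C in [set C : R | (0 <= C)%R /\ has_type2_with F C]].

End type2.

(* Main.v *)
(** Write [phi a = a |a|] and [D x y = || (phi <X_j,x> - phi <X_j,y>)_j ||_2].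
   Then [D] is a metric dominating the increments of the Rademacher process
   [sum_j eps_j <X_j,y>^2], and it is compatible with midpoints because [phi] is
   monotone.  Let [pi_n x] nearly minimize [|u|^2 + t_n D x u] over the unit ball,
   with [t_n] proportional to [2^n].  Interpolation gives that the sum over [n] of
   [t_n D x (pi_n x)] is bounded, and testing the minimization at midpoints shows
   that uniform convexity turns a set of small [D]-diameter into a set whose image
   under [pi_n] has small norm diameter.

   Such a set contains few [D]-separated points [z_i]: attach to each of them the
   functional [b_i = sum_j (<X_j,z_i>^3 - <X_j,z_0>^3) X_j].  By monotonicity of the
   cube, separation in [D] forces separation of the [b_i] in the dual norm; on the
   other hand each [b_i] is the mean of an average of independent random multiples of
   the [X_j], whose fluctuations are controlled by type 2, and whose law has a bounded
   chi-square divergence from one fixed law.  Disjointness of the events that the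
   sample is close to [b_i] then bounds the number of points.  For the part of the increment
   quadratic in [<X_j,z_0>] the divergence is that of a Gaussian shift, for the rest it
   costs a factor [2m] per sample, as in Maurey's empirical method.

   Refining partitions with these covering bounds, as in the contraction principle for
   generic chaining, sums the increments to [lambda^2 T_2 sqrt(log m) max|X_j| sup]. *)
Require Import Defs.
From HB Require Import structures.
From mathcomp Require Import all_boot all_order all_algebra.
From mathcomp Require Import all_classical all_reals all_analysis.
From mathcomp Require Import measurable_realfun ring lra.

Set Implicit Arguments.
Unset Strict Implicit.
Unset Printing Implicit Defensive.

Import Order.TTheory GRing.Theory Num.Theory.
Import numFieldNormedType.Exports.

Local Open Scope ring_scope.

(** * The signed square *)

Section l2norm.
Context {R : realType} {I : finType}.
Implicit Types f g h : I -> R.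

Definition l2norm f : R := Num.sqrt (\sum_i f i ^+ 2).

Lemma sum_sqr_ge0 f : 0 <= \sum_i f i ^+ 2.
Proof. by apply: sumr_ge0 => i _; exact: sqr_ge0. Qed.

Lemma l2norm_ge0 f : 0 <= l2norm f. Proof. exact: sqrtr_ge0. Qed.

Lemma l2norm_sqr f : l2norm f ^+ 2 = \sum_i f i ^+ 2.
Proof. by rewrite sqr_sqrtr// sum_sqr_ge0. Qed.

Lemma l2norm_le f (c : R) : 0 <= c -> \sum_i f i ^+ 2 <= c ^+ 2 -> l2norm f <= c.
Proof.
by move=> c0 fc; rewrite -(ger0_norm c0) -sqrtr_sqr ler_wsqrtr.
Qed.

Lemma l2norm_mono f g : (forall i, `|f i| <= `|g i|) -> l2norm f <= l2norm g.
Proof.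
move=> fg; rewrite ler_wsqrtr// ler_sum// => i _.
by rewrite -(real_normK (num_real (f i))) -(real_normK (num_real (g i))) lerXn2r ?nnegrE.
Qed.

Lemma l2normZ (c : R) f : 0 <= c -> l2norm (fun i => c * f i) = c * l2norm f.
Proof.
move=> c0; rewrite /l2norm; under eq_bigr do rewrite exprMn.
by rewrite -mulr_sumr sqrtrM ?sqr_ge0// sqrtr_sqr ger0_norm.
Qed.

Lemma l2norm_eq0 f : l2norm f = 0 -> forall i, f i = 0.
Proof.
move=> f0 i; have := l2norm_sqr f; rewrite f0 expr0n/= => /esym/eqP.
rewrite psumr_eq0; last by move=> j _; exact: sqr_ge0.
by move/allP/(_ i (mem_index_enum i)); rewrite sqrf_eq0 => /eqP.
Qed.

Lemma cauchy_schwarz f g : \sum_i f i * g i <= l2norm f * l2norm g.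
Proof.
have [f0|f0] := eqVneq (l2norm f) 0.
  by rewrite big1 ?f0 ?mul0r// => i _; rewrite (l2norm_eq0 f0) mul0r.
have [g0|g0] := eqVneq (l2norm g) 0.
  by rewrite big1 ?g0 ?mulr0// => i _; rewrite (l2norm_eq0 g0) mulr0.
have {}f0 : 0 < l2norm f by rewrite lt_neqAle eq_sym f0 l2norm_ge0.
have {}g0 : 0 < l2norm g by rewrite lt_neqAle eq_sym g0 l2norm_ge0.
have : 0 <= \sum_i (l2norm g * f i - l2norm f * g i) ^+ 2 by exact: sum_sqr_ge0.
rewrite (eq_bigr (fun i =>
  l2norm g ^+ 2 * f i ^+ 2 + l2norm f ^+ 2 * g i ^+ 2
  + (- (2 * l2norm f * l2norm g)) * (f i * g i))); last by move=> i _; ring.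
rewrite !big_split/= -!mulr_sumr -!l2norm_sqr => H.
have : 0 <= 2 * (l2norm f * l2norm g) * (l2norm f * l2norm g - \sum_i f i * g i) by lra.
by rewrite pmulr_rge0 ?mulr_gt0// subr_ge0.
Qed.

Lemma l2normD f g : l2norm (fun i => f i + g i) <= l2norm f + l2norm g.
Proof.
apply: l2norm_le; first by rewrite addr_ge0// l2norm_ge0.
rewrite (eq_bigr (fun i => f i ^+ 2 + g i ^+ 2 + 2 * (f i * g i))); last by move=> i _; ring.
rewrite !big_split/= -mulr_sumr -!l2norm_sqr; have := cauchy_schwarz f g; lra.
Qed.

End l2norm.

Section signed_square.
Context {R : realType}.
Implicit Types a b c : R.

(** This is the function phi of the overview: an increasing substitute for the square whose
    increments are at least as large ([sqr_sub_le_ssqr]). *)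
Definition ssqr a : R := a * `|a|.

Lemma ssqr_le a b : a <= b -> ssqr a <= ssqr b.
Proof.
move=> ab; rewrite /ssqr; have [a0|a0] := leP 0 a; have [b0|b0] := leP 0 b.
- by rewrite !ger0_norm//; nra.
- lra.
- by rewrite (ltr0_norm a0) (ger0_norm b0); nra.
- by rewrite (ltr0_norm a0) (ltr0_norm b0); nra.
Qed.

(** For equal signs a difference of squares factors; for opposite signs the two squares add up. The
    comparisons of increments below rest on these two cases, zero counting as nonnegative. *)
Lemma ssqr_subE a b : `|ssqr a - ssqr b| =
  if (0 <= a) == (0 <= b) then `|a - b| * (`|a| + `|b|) else a ^+ 2 + b ^+ 2.
Proof.
rewrite /ssqr; have [a0|a0] := leP 0 a; have [b0|b0] := leP 0 b => /=.
- rewrite (ger0_norm a0) (ger0_norm b0) (_ : a * a - b * b = (a - b) * (a + b)).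
    by rewrite normrM (@ger0_norm _ (a + b))//; lra.
  by ring.
- by rewrite (ger0_norm a0) (ltr0_norm b0) ger0_norm; [ring|nra].
- by rewrite (ltr0_norm a0) (ger0_norm b0) ler0_norm; nra.
- rewrite (ltr0_norm a0) (ltr0_norm b0).
  rewrite (_ : a * - a - b * - b = (a - b) * (- a - b)); last by ring.
  by rewrite normrM (@ger0_norm _ (- a - b))//; lra.
Qed.

Lemma sqr_sub_le_ssqr a b : `|a ^+ 2 - b ^+ 2| <= `|ssqr a - ssqr b|.
Proof.
rewrite ssqr_subE; case: ifP => _.
  by rewrite subr_sqr normrM ler_wpM2l// ler_normD.
by rewrite ler_norml; have := sqr_ge0 a; have := sqr_ge0 b => *; apply/andP; split; lra.
Qed.

(** Quantitative monotonicity of the cube: summed over coordinates, it bounds [sqdist] squared by a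
    pairing of cube increments with differences. For equal signs it follows from
    [(|a| + |b|)^2 <= 4 (a^2 + a b + b^2)]. *)
Lemma ssqr_sub_sqr_le a b :
  (ssqr a - ssqr b) ^+ 2 <= 4 * ((a ^+ 3 - b ^+ 3) * (a - b)).
Proof.
have -> : (a ^+ 3 - b ^+ 3) * (a - b) = (a - b) ^+ 2 * (a ^+ 2 + a * b + b ^+ 2) by ring.
rewrite -real_normK ?num_real// ssqr_subE; case: ifPn => ab.
  rewrite exprMn real_normK ?num_real// (mulrCA 4) ler_wpM2l ?sqr_ge0//.
  have -> : (`|a| + `|b|) ^+ 2 = a ^+ 2 + 2 * `|a * b| + b ^+ 2.
    by rewrite sqrrD !real_normK ?num_real// normrM; ring.
  rewrite ger0_norm.
    by have := sqr_ge0 (a + b); have := sqr_ge0 a; have := sqr_ge0 b; lra.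
  by move: ab; have [a0|a0] := leP 0 a; have [b0|b0] := leP 0 b => // _; nra.
have ab0 : a * b <= 0.
  by move: ab; have [a0|a0] := leP 0 a; have [b0|b0] := leP 0 b => // _; nra.
suff : 0 <= (a ^+ 2 + b ^+ 2 - 2 * (a * b)) * (4 * (a ^+ 2 + a * b + b ^+ 2)) - (a ^+ 2 + b ^+ 2) ^+ 2.
  by move=> H; rewrite -subr_ge0; apply: le_trans H _; lra.
(* With these names the claim is [3 s^2 - 4 s p - 8 p^2 >= 0] on the range [- s / 2 <= p <= 0]. *)
set s := a ^+ 2 + b ^+ 2; set p := a * b in ab0 *.
have s0 : 0 <= s + 2 * p by rewrite /s /p; have := sqr_ge0 (a + b); lra.
have -> : a ^+ 2 + p + b ^+ 2 = s + p by rewrite /s; ring.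
nra.
Qed.

Lemma sqr_sub_le2_ssqr a b : (a - b) ^+ 2 <= 2 * `|ssqr a - ssqr b|.
Proof.
rewrite ssqr_subE; case: ifPn => ab.
  rewrite -real_normK ?num_real// expr2 (mulrCA 2) ler_wpM2l//.
  by have := ler_normB a b; have := normr_ge0 a; have := normr_ge0 b; lra.
by have := sqr_ge0 (a + b); lra.
Qed.

Lemma norm_mul_sub_le_ssqr a b : `|a * (a - b)| <= 2 * `|ssqr a - ssqr b|.
Proof.
rewrite ssqr_subE; case: ifPn => ab.
  rewrite normrM mulrC (mulrCA 2) ler_wpM2l//.
  by have := normr_ge0 a; have := normr_ge0 b; lra.
rewrite ler_norml; have := sqr_ge0 (a + b); have := sqr_ge0 (a - b).
by have := sqr_ge0 a; have := sqr_ge0 b => *; apply/andP; split; lra.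
Qed.

(** Since [ssqr] is increasing, its value at the midpoint lies between those at [b] and [c]. This
    lets [sqdist] be tested at midpoints together with the convexity of the norm. *)
Lemma ssqr_mid a b c :
  `|ssqr a - ssqr (2^-1 * (b + c))| <= `|ssqr a - ssqr b| + `|ssqr a - ssqr c|.
Proof.
wlog bc : b c / b <= c.
  move=> H; have [bc|cb] := leP b c; first exact: H.
  by rewrite (addrC b) (addrC `|ssqr a - ssqr b|) H// ltW.
have h1 : ssqr b <= ssqr (2^-1 * (b + c)) by apply: ssqr_le; lra.
have h2 : ssqr (2^-1 * (b + c)) <= ssqr c by apply: ssqr_le; lra.
have := ler_norm (ssqr a - ssqr b); have := ler_norm (ssqr c - ssqr a).
rewrite (distrC (ssqr c)) ler_norml => n1 n2.
have := normr_ge0 (ssqr a - ssqr b); have := normr_ge0 (ssqr a - ssqr c).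
by move=> n3 n4; apply/andP; split; lra.
Qed.

End signed_square.

(** * Samples separating points *)

(** Averages over signs are written as sums over all sign patterns, their number being moved to the
    other side. The index type is arbitrary because the samples below are indexed by a disjoint
    sum. *)
Definition rademacher_type2 {R : realType} (F : normedModType R) (tau : R) :=
  forall (L : finType) (x : L -> F),
    \sum_(s : {ffun L -> bool}) `|\sum_l (-1) ^+ s l *: x l|
    <= 2 ^+ #|L| * (tau * l2norm (fun l => `|x l|)).

Section sampling.
Context {R : realType} {F : normedModType R} {L Om : finType}.
Implicit Types (p : L -> Om -> R) (Y : L -> Om -> F).

(** The law of a sample with independent coordinates, the coordinate at [l] having law [p l]. *)
Definition product_weight p (w : {ffun L -> Om}) : R := \prod_l p l (w l).

Definition is_distribution p :=
  (forall l o, 0 <= p l o) /\ (forall l, \sum_o p l o = 1).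

Lemma product_weight_ge0 p w : is_distribution p -> 0 <= product_weight p w.
Proof. by move=> [p0 _]; exact: prodr_ge0. Qed.

Lemma sum_product_weight p :
  \sum_w product_weight p w = \prod_l \sum_o p l o.
Proof. by rewrite /product_weight bigA_distr_bigA. Qed.

Lemma sum_product_weight1 p : is_distribution p -> \sum_w product_weight p w = 1.
Proof. by move=> [_ p1]; rewrite sum_product_weight big1. Qed.

Lemma product_weight_marginal p l o : is_distribution p ->
  \sum_(w : {ffun L -> Om} | w l == o) product_weight p w = p l o.
Proof.
move=> [p0 p1]; rewrite big_mkcond/=.
(* Cutting the law [p l] down to the value [o] turns the restricted sum into the full sum of a
   product weight. *)
pose q l' o' := if l' == l then (if o' == o then p l' o' else 0) else p l' o'.
rewrite (eq_bigr (product_weight q)) => [|w _].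
  rewrite sum_product_weight (bigD1 l)//= [X in _ * X]big1 => [|l' ll'].
    by rewrite /q eqxx -big_mkcond/= big_pred1_eq mulr1.
  by rewrite /q (negbTE ll') p1.
have ql : q l (w l) = if w l == o then p l (w l) else 0 by rewrite /q eqxx.
rewrite /product_weight [RHS](bigD1 l)//= ql.
case: ifP => _; last by rewrite mul0r.
rewrite (bigD1 l)//=; congr (_ * _).
by apply: eq_bigr => l' ll'; rewrite /q (negbTE ll').
Qed.

Definition sampling_mean p Y : F := \sum_l \sum_o p l o *: Y l o.

Lemma sampling_meanE p Y : is_distribution p ->
  \sum_w product_weight p w *: \sum_l Y l (w l) = sampling_mean p Y.
Proof.
move=> pd; rewrite /sampling_mean.
under eq_bigr do rewrite scaler_sumr.
rewrite exchange_big/=; apply: eq_bigr => l _.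
rewrite (partition_big (fun w : {ffun L -> Om} => w l) xpredT)//=.
apply: eq_bigr => o _; rewrite -(product_weight_marginal l o pd) scaler_suml.
by apply: eq_bigr => w /eqP ->.
Qed.

(** Exchanging two independent copies at the positions marked by [s] preserves their joint weight
    and multiplies the difference at [l] by [(-1) ^+ s l]. *)
Definition swap_on (s : {ffun L -> bool}) (ww : {ffun L -> Om} * {ffun L -> Om}) :=
  ([ffun l => if s l then ww.2 l else ww.1 l],
   [ffun l => if s l then ww.1 l else ww.2 l]) : {ffun L -> Om} * {ffun L -> Om}.

Lemma swap_onK s : involutive (swap_on s).
Proof.
move=> [w w']; rewrite /swap_on/=; congr pair; apply/ffunP => l; rewrite !ffunE.
  by case: (s l).
by case: (s l).
Qed.

(* Symmetrization against an independent copy of the sample. *)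
Lemma sampling_deviation (tau : R) p Y (M : L -> R) :
  0 <= tau -> rademacher_type2 F tau ->
  is_distribution p -> (forall l o, `|Y l o| <= M l) ->
  \sum_w product_weight p w * `|\sum_l Y l (w l) - sampling_mean p Y|
  <= 2 * tau * l2norm M.
Proof.
move=> tau0 Ftau pd YM.
(* Nonnegativity of [M l] is available only once [Om] has an element, so a sample is taken as
   argument. *)
have M0 l : {w : {ffun L -> Om} | true} -> 0 <= M l.
  by move=> [w _]; exact: le_trans (normr_ge0 _) (YM l (w l)).
pose W := ({ffun L -> Om} * {ffun L -> Om})%type.
pose PP (v : W) := product_weight p v.1 * product_weight p v.2.
have PP0 v : 0 <= PP v by rewrite mulr_ge0// product_weight_ge0.
have PP1 : \sum_v PP v = 1.
  rewrite -(pair_bigA _ (fun w w' => product_weight p w * product_weight p w'))/=.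
  under eq_bigr do rewrite -mulr_sumr sum_product_weight1// mulr1.
  exact: sum_product_weight1.
pose Q := \sum_(v : W) PP v * `|\sum_l (Y l (v.1 l) - Y l (v.2 l))|.
(* By convexity of the norm, replacing the mean by an independent copy of the sample can only
   increase the average. *)
apply: (@le_trans _ _ Q).
  rewrite /Q -(pair_bigA _ (fun w w' => product_weight p w * product_weight p w' *
    `|\sum_l (Y l (w l) - Y l (w' l))|))/=.
  apply: ler_sum => w _.
  under [leRHS]eq_bigr do rewrite -mulrA.
  rewrite -mulr_sumr ler_wpM2l ?product_weight_ge0//.
  rewrite -(sampling_meanE Y pd).
  rewrite -[X in `|X - _|]scale1r -(sum_product_weight1 pd) scaler_suml.
  rewrite -sumrB (le_trans (ler_norm_sum _ _ _))// ler_sum// => w' _.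
  by rewrite -scalerBr normrZ ger0_norm ?product_weight_ge0// -sumrB.
(* The swap shows that [Q] does not change when signs are inserted; averaging over [s] then brings
   in type 2. *)
have QE (s : {ffun L -> bool}) :
    Q = \sum_(v : W) PP v * `|\sum_l (-1) ^+ s l *: (Y l (v.1 l) - Y l (v.2 l))|.
  rewrite /Q (reindex_inj (inv_inj (swap_onK s)))/=; apply: eq_bigr => -[w w'] _ /=.
  congr *%R.
    rewrite /PP/= /product_weight -!big_split/=; apply: eq_bigr => l _.
    by rewrite !ffunE; case: (s l) => //; rewrite mulrC.
  congr Num.norm; apply: eq_bigr => l _; rewrite !ffunE; case: (s l) => /=.
    by rewrite expr1 scaleN1r opprB.
  by rewrite expr0 scale1r.
have L2 : 0 < (2 : R) ^+ #|L| by rewrite exprn_gt0.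
rewrite -(ler_pM2l L2).
have -> : 2 ^+ #|L| * Q = \sum_(s : {ffun L -> bool}) Q.
  by rewrite sumr_const card_ffun card_bool -[RHS]mulr_natl natrX.
under eq_bigr => s _ do rewrite (QE s).
rewrite exchange_big/=.
apply: (@le_trans _ _ (\sum_v PP v * (2 ^+ #|L| * (2 * tau * l2norm M)))).
  apply: ler_sum => v _; rewrite -mulr_sumr ler_wpM2l//.
  rewrite (le_trans (Ftau _ _))// ler_wpM2l ?(ltW L2)//.
  rewrite (_ : 2 * tau * _ = tau * (2 * l2norm M)); last by ring.
  rewrite ler_wpM2l// -l2normZ//; apply: l2norm_mono => l; rewrite normr_id.
  rewrite ger0_norm; last by rewrite mulr_ge0// (M0 l)//; exists v.1.
  rewrite (le_trans (ler_normB _ _))//.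
  by have := YM l (v.1 l); have := YM l (v.2 l); lra.
by rewrite -mulr_suml PP1 mul1r.
Qed.

(** By Markov's inequality each law [p i] gives mass at least 1/2 to the samples close to its mean,
    and these events are disjoint because the means are far apart. As [chi] bounds the second moment
    of the density relative to the uniform law, Cauchy-Schwarz forces each event to have uniform
    mass at least [1 / (4 chi)]. *)
Lemma sampling_separation (I : finType) (tau chi : R) (p : I -> L -> Om -> R) Y
    (M : L -> R) :
  rademacher_type2 F tau -> 0 < tau * l2norm M -> 0 <= tau -> 0 <= chi ->
  (0 < #|Om|)%N -> (forall i, is_distribution (p i)) -> (forall l o, `|Y l o| <= M l) ->
  (forall i, \prod_l (#|Om|%:R * \sum_o p i l o ^+ 2) <= chi) ->
  (forall i k, i != k ->
    8 * (tau * l2norm M) < `|sampling_mean (p i) Y - sampling_mean (p k) Y|) ->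
  #|I|%:R <= 4 * chi.
Proof.
move=> Ftau tM0 tau0 chi0 Om0 pd YM pchi sep.
(* The radius is twice the mean deviation of [sampling_deviation], which leaves probability one
   half, and half of the separation, which makes the events disjoint. *)
pose S i := [set w : {ffun L -> Om} |
  `|\sum_l Y l (w l) - sampling_mean (p i) Y| <= 4 * (tau * l2norm M)]%SET.
have PS i : 2^-1 <= \sum_(w in S i) product_weight (p i) w.
  have := sampling_deviation tau0 Ftau (pd i) YM.
  have -> : \sum_(w in S i) product_weight (p i) w =
    1 - \sum_(w in ~: S i) product_weight (p i) w.
    rewrite -(sum_product_weight1 (pd i)) [in RHS](bigID (mem (S i)))/=.
    rewrite (eq_bigl (fun w => w \in ~: S i) _ (fun w => esym (finset.in_setC w (S i)))).
    by rewrite addrK.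
  set c := tau * l2norm M in tM0 *; rewrite -mulrA -/c => H.
  have : \sum_(w in ~: S i) product_weight (p i) w * (4 * c) <= 2 * c.
    apply: le_trans H; rewrite [leRHS](bigID (mem (S i)))/= -[leLHS]add0r lerD//.
      by apply: sumr_ge0 => w _; rewrite mulr_ge0// product_weight_ge0.
    under [leRHS]eq_bigl do rewrite -finset.in_setC.
    apply: ler_sum => w; rewrite !inE -ltNge => wS.
    by rewrite ler_wpM2l ?product_weight_ge0// ltW.
  rewrite -mulr_suml; set q := \sum_(_ in _) _ => H2.
  have : c * (4 * q - 2) <= 0 by lra.
  by rewrite pmulr_rle0//; lra.
pose n : R := (#|Om| ^ #|L|)%:R.
have Sn i : n <= 4 * chi * #|S i|%:R.
  have P2 : n * \sum_w product_weight (p i) w ^+ 2 <= chi.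
    apply: le_trans (pchi i).
    rewrite (eq_bigr (product_weight (fun l o => p i l o ^+ 2))); last first.
      by move=> w _; rewrite /product_weight prodrXl.
    rewrite sum_product_weight.
    by rewrite big_split/= prodr_const /n natrX.
  have CS : (\sum_(w in S i) product_weight (p i) w) ^+ 2 <=
      #|S i|%:R * \sum_w product_weight (p i) w ^+ 2.
    have := cauchy_schwarz (fun w => (w \in S i)%:R) (product_weight (p i)).
    have -> : \sum_w (w \in S i)%:R * product_weight (p i) w =
              \sum_(w in S i) product_weight (p i) w.
      rewrite [RHS]big_mkcond/=; apply: eq_bigr => w _.
      by case: (_ \in _); rewrite ?mul1r ?mul0r.
    move=> CS; have : 0 <= \sum_(w in S i) product_weight (p i) w.
      by apply: sumr_ge0 => w _; rewrite product_weight_ge0.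
    move=> P0; rewrite (le_trans (_ : _ <= (l2norm (fun w => (w \in S i)%:R) *
        l2norm (product_weight (p i))) ^+ 2))//.
      by rewrite lerXn2r// nnegrE// mulr_ge0// l2norm_ge0.
    rewrite exprMn !l2norm_sqr ler_wpM2r ?sum_sqr_ge0//.
    rewrite (eq_bigr (fun w => if w \in S i then 1 else 0)).
      by rewrite -big_mkcond/= sumr_const.
    by move=> w _; case: (_ \in _); rewrite ?expr1n ?expr0n.
  have PS2 : 4^-1 <= (\sum_(w in S i) product_weight (p i) w) ^+ 2.
    by have := PS i; nra.
  have n0 : 0 <= n by rewrite ler0n.
  have s0 : 0 <= #|S i|%:R :> R by rewrite ler0n.
  have H : n * 4^-1 <= n * (#|S i|%:R * \sum_w product_weight (p i) w ^+ 2).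
    by rewrite ler_wpM2l// (le_trans PS2).
  have H2 : #|S i|%:R * (n * \sum_w product_weight (p i) w ^+ 2) <= #|S i|%:R * chi.
    by rewrite ler_wpM2l.
  by lra.
(* Double counting: each sample lies in at most one [S i]. *)
have disj : (\sum_i #|S i| <= #|Om| ^ #|L|)%N.
  rewrite -card_ffun -cardsT.
  rewrite (eq_bigr (fun i => \sum_(w : {ffun L -> Om}) (w \in S i))%N); last first.
    by move=> i _; rewrite -sum1_card big_mkcond; apply: eq_bigr => w _; case: (_ \in _).
  rewrite exchange_big/= -sum1_card; apply: (leq_trans (n := \sum_(w : {ffun L -> Om}) 1)%N).
    apply: leq_sum => w _.
    case: (pickP (fun i => w \in S i)) => [i iS|]; last by move=> S0; rewrite big1// => i _; rewrite S0.
    rewrite (bigD1 i)//= iS big1// => k ki; case: (boolP (w \in S k)) => // kS.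
    have := sep _ _ ki; move: iS kS; rewrite !inE => iS kS.
    rewrite ltNge => /negP[]; rewrite -(subrK (\sum_l Y l (w l)) (sampling_mean (p k) Y)).
    rewrite -addrA (le_trans (ler_normD _ _))//.
    by rewrite distrC (le_trans (lerD kS iS))//; lra.
  by apply: eq_leq; apply: eq_bigl => w; rewrite inE.
have n0 : 0 < n by rewrite /n ltr0n expn_gt0 Om0.
rewrite -(ler_pM2r n0) (_ : #|I|%:R * n = \sum_(i : I) n); last first.
  by rewrite sumr_const mulr_natl.
apply: (@le_trans _ _ (\sum_(i : I) 4 * chi * #|S i|%:R)).
  by apply: ler_sum => i _; exact: Sn.
rewrite -mulr_sumr -natr_sum ler_wpM2l ?mulr_ge0//.
by rewrite /n ler_nat.
Qed.

End sampling.

(** * Counting separated linear combinations by sampling *)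

Section separated_combinations.
Context {R : realType} {F : normedModType R} {I : finType} {m n k : nat}.
Variables (X : 'I_m -> F) (w : 'I_m -> R) (alpha beta : I -> 'I_m -> R).
Variables (tau M A rho B c0 : R).
Hypotheses (m0 : (0 < m)%N) (n0 : (0 < n)%N) (k0 : (0 < k)%N).
Hypotheses (B0 : 0 < B) (c00 : 0 < c0) (M0 : 0 < M).
Hypothesis XM : forall j, `|X j| <= M.
Hypothesis wA : l2norm w <= A.
Hypothesis w0 : forall j, 0 <= w j.
Hypothesis alpha_rho : forall i, l2norm (fun j => w j * alpha i j) <= rho.
Hypothesis alphan : forall i j, `|w j * alpha i j| <= c0 * n%:R.
Hypothesis betaB : forall i, \sum_j `|beta i j| <= B.

(** The left block holds [n * n] draws for each index, the right block [k] draws. Both use one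
    alphabet, a sign with an index, so that all laws are compared with the uniform law on the same
    set. *)
Let L : finType := (('I_m * 'I_(n * n)) + 'I_k)%type.
Let Om : finType := (bool * 'I_m)%type.
Let delta i j := w j * alpha i j / (c0 * n%:R).

(* The samples in the left block draw a sign with bias [delta], a discrete version of
   a Gaussian shift; those in the right block draw an index with probability
   [|beta|/B], the remaining mass being spread uniformly. *)
Let p (i : I) (l : L) (o : Om) : R :=
  match l with
  | inl jl => (1 + (-1) ^+ o.1 * delta i jl.1) / (2 * m%:R)
  | inr _ => (`|beta i o.2| + (-1) ^+ o.1 * beta i o.2) / (2 * B)
             + (1 - (\sum_j `|beta i j|) / B) / (2 * m%:R)
  end.

Let Y (l : L) (o : Om) : F :=
  match l with
  | inl jl => ((-1) ^+ o.1 * (w jl.1 * c0 / n%:R)) *: X jl.1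
  | inr _ => ((-1) ^+ o.1 * (B / k%:R)) *: X o.2
  end.

Let MY (l : L) : R :=
  match l with
  | inl jl => w jl.1 * c0 / n%:R * M
  | inr _ => B / k%:R * M
  end.

Let mR : 0 < m%:R :> R. Proof. by rewrite ltr0n. Qed.
Let nR : 0 < n%:R :> R. Proof. by rewrite ltr0n. Qed.
Let kR : 0 < k%:R :> R. Proof. by rewrite ltr0n. Qed.

Let sum_Om (V : nmodType) (f : Om -> V) :
  \sum_o f o = \sum_j (f (false, j) + f (true, j)).
Proof.
rewrite (eq_bigr (fun o => f (o.1, o.2))) => [|[]//].
rewrite -(pair_bigA _ (fun b j => f (b, j)))/= exchange_big/=.
by apply: eq_bigr => j _; rewrite big_bool addrC.
Qed.

Let delta_le1 i j : `|delta i j| <= 1.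
Proof.
rewrite /delta normrM normfV (gtr0_norm (mulr_gt0 c00 nR)).
by rewrite ler_pdivrMr ?mulr_gt0// mul1r.
Qed.

Let p_distr i : is_distribution (p i).
Proof.
split=> [l o|l].
  case: l => [[j l]|l] /=.
    rewrite divr_ge0 ?mulr_ge0// ?(ltW mR)//.
    have := delta_le1 i j; rewrite ler_norml => /andP[d1 d2].
    by case: o.1 => /=; rewrite ?expr1 ?expr0; lra.
  rewrite addr_ge0//.
    rewrite divr_ge0 ?mulr_ge0// ?(ltW B0)//.
    have := ler_norm (beta i o.2); have := ler_norm (- beta i o.2); rewrite normrN.
    by case: o.1 => /=; rewrite ?expr1 ?expr0; lra.
  rewrite divr_ge0 ?mulr_ge0// ?(ltW mR)//.
  by rewrite subr_ge0 ler_pdivrMr// mul1r.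
rewrite sum_Om//; case: l => [[j l]|l] /=.
  rewrite (eq_bigr (fun=> m%:R^-1)) => [|j' _]; last first.
    by rewrite ?expr0 ?expr1 /=; field; rewrite gt_eqF.
  by rewrite sumr_const card_ord -[LHS]mulr_natl mulfV// gt_eqF.
set S := \sum_(j < m) `|beta i j|.
rewrite (eq_bigr (fun j => `|beta i j| / B + (1 - S / B) / m%:R)) => [|j' _]; last first.
  by rewrite ?expr0 ?expr1 /=; field; rewrite !gt_eqF.
rewrite big_split/= -mulr_suml sumr_const card_ord -[X in _ + X]mulr_natl -/S.
by field; rewrite !gt_eqF.
Qed.

Let Y_norm l o : `|Y l o| <= MY l.
Proof.
have s1 (b : bool) : `|(-1) ^+ b| = 1 :> R by rewrite normrX normrN1 expr1n.
case: l => [[j l]|l] /=; rewrite normrZ normrM s1 mul1r ger0_norm ?ler_wpM2l//.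
- by rewrite !mulr_ge0// ?ltW// invr_gt0.
- by rewrite !mulr_ge0// ?ltW// invr_gt0.
- by rewrite mulr_ge0// ?ltW// invr_gt0.
- by rewrite mulr_ge0// ?ltW// invr_gt0.
Qed.

(** Each of the [n * n] left draws at [j] contributes [w j * c0 / n] times its bias [delta i j], in
    total [w j ^+ 2 * alpha i j]. Each of the [k] right draws has mean coefficients
    [beta i j / k]. *)
Let mean_p i :
  sampling_mean (p i) Y = \sum_j (w j ^+ 2 * alpha i j + beta i j) *: X j.
Proof.
rewrite /sampling_mean big_sumType/=.
rewrite (eq_bigr (fun j => (w j ^+ 2 * alpha i j) *: X j + beta i j *: X j)); last first.
  by move=> j _; rewrite scalerDl.
rewrite big_split/=; congr +%R.
  rewrite -(pair_bigA _ (fun j l => \sum_o p i (inl (j, l)) o *: Y (inl (j, l)) o))/=.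
  apply: eq_bigr => j _.
  rewrite (eq_bigr (fun=> (w j ^+ 2 * alpha i j / (n%:R * n%:R)) *: X j)) => [|l _].
    rewrite sumr_const card_ord -scaler_nat scalerA natrM; congr (_ *: _).
    by field; rewrite gt_eqF.
  rewrite sum_Om//= (eq_bigr (fun=> (w j ^+ 2 * alpha i j / (n%:R * n%:R) / m%:R) *: X j)).
    rewrite sumr_const card_ord -scaler_nat scalerA; congr (_ *: _).
    by field; rewrite !gt_eqF.
  move=> j' _; rewrite !scalerA -scalerDl; congr (_ *: _).
  by rewrite /delta expr0 expr1; field; rewrite !gt_eqF.
rewrite (eq_bigr (fun=> \sum_j (beta i j / k%:R) *: X j)) => [|l _]; last first.
  rewrite sum_Om//=; apply: eq_bigr => j _.
  rewrite !scalerA -scalerDl; congr (_ *: _).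
  by rewrite ?expr0 ?expr1 /=; field; rewrite !gt_eqF.
rewrite sumr_const card_ord -scaler_nat scaler_sumr; apply: eq_bigr => j _.
by rewrite scalerA; congr (_ *: _); field; rewrite gt_eqF.
Qed.

(** A left draw contributes [1 + delta^2], and the [n * n] draws at [j] together at most
    [exp ((w j * alpha i j)^2 / c0^2)], a bound free of [n]. A right draw contributes at most the
    size [2 m] of the alphabet, since probabilities are at most 1. *)
Let chi_p i : \prod_l (#|Om|%:R * \sum_o p i l o ^+ 2)
  <= expR (rho ^+ 2 / c0 ^+ 2) * (2 * m%:R) ^+ k.
Proof.
have OmE : #|Om|%:R = 2 * m%:R :> R by rewrite card_prod card_bool card_ord natrM.
rewrite big_sumType/= OmE ler_pM//.
- by apply: prodr_ge0 => l _; rewrite mulr_ge0 ?mulr_ge0// ?sumr_ge0// => o _; rewrite sqr_ge0.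
- by apply: prodr_ge0 => l _; rewrite mulr_ge0 ?mulr_ge0// ?sumr_ge0// => o _; rewrite sqr_ge0.
- rewrite -(pair_bigA _ (fun j l => 2 * m%:R * \sum_o p i (inl (j, l)) o ^+ 2))/=.
  apply: (@le_trans _ _ (\prod_(j < m) expR ((w j * alpha i j) ^+ 2 / c0 ^+ 2))).
    apply: ler_prod => j _; apply/andP; split.
      by apply: prodr_ge0 => l _; rewrite mulr_ge0 ?mulr_ge0// ?sumr_ge0// => o _; rewrite sqr_ge0.
    rewrite (eq_bigr (fun=> 1 + delta i j ^+ 2)) => [|l _]; last first.
      rewrite sum_Om//= (eq_bigr (fun=> (1 + delta i j ^+ 2) / (2 * m%:R * m%:R))).
        by rewrite sumr_const card_ord -[X in _ * X]mulr_natl; field; rewrite gt_eqF.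
      by move=> j' _; rewrite ?expr0 ?expr1 /=; field; rewrite gt_eqF.
    rewrite prodr_const card_ord.
    have -> : (w j * alpha i j) ^+ 2 / c0 ^+ 2 = delta i j ^+ 2 *+ (n * n).
      by rewrite /delta -mulr_natl natrM; field; rewrite !gt_eqF.
    rewrite -[X in expR X]mulr_natl expRM_natl lerXn2r ?nnegrE ?expR_ge0// ?expR_ge1Dx//.
    by rewrite addr_ge0// sqr_ge0.
  rewrite -expR_sum ler_expR -mulr_suml ler_wpM2r//.
    by rewrite invr_ge0 sqr_ge0.
  by rewrite -l2norm_sqr lerXn2r ?nnegrE// ?l2norm_ge0// (le_trans (l2norm_ge0 _) (alpha_rho i)).
- rewrite -[X in _ ^+ X]card_ord -prodr_const; apply: ler_prod => l _; apply/andP; split.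
    by rewrite mulr_ge0 ?mulr_ge0// ?sumr_ge0// => o _; rewrite sqr_ge0.
  rewrite -[leRHS]mulr1 ler_wpM2l ?mulr_ge0//.
  have [p0 p1] := p_distr i; rewrite -[leRHS](p1 (inr l)); apply: ler_sum => o _.
  rewrite -[leRHS]mulr1 expr2; apply: ler_wpM2l; first exact: (p0 (inr l) o).
  rewrite -[leRHS](p1 (inr l)) (bigD1 o)//= lerDl.
  by apply: sumr_ge0 => o' _; exact: (p0 (inr l) o').
Qed.

Let MY_le : l2norm MY <= M * Num.sqrt (c0 ^+ 2 * A ^+ 2 + B ^+ 2 / k%:R).
Proof.
have A0 : 0 <= A := le_trans (l2norm_ge0 _) wA.
apply: l2norm_le; first by rewrite mulr_ge0// ?sqrtr_ge0// ltW.
rewrite exprMn sqr_sqrtr; last first.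
  by apply: addr_ge0; [rewrite mulr_ge0 ?sqr_ge0|rewrite divr_ge0 ?sqr_ge0].
rewrite mulrDr big_sumType/= lerD//.
  rewrite -(pair_bigA _ (fun j l => (w j * c0 / n%:R * M) ^+ 2))/=.
  rewrite (eq_bigr (fun j => M ^+ 2 * c0 ^+ 2 * w j ^+ 2)).
    rewrite -mulr_sumr -mulrA ler_wpM2l ?sqr_ge0// ler_wpM2l ?sqr_ge0//.
    by rewrite -l2norm_sqr lerXn2r// nnegrE// l2norm_ge0.
  move=> j _; rewrite sumr_const card_ord -[LHS]mulr_natl natrM.
  by field; rewrite gt_eqF.
rewrite sumr_const card_ord -[leLHS]mulr_natl le_eqVlt; apply/orP; left; apply/eqP.
by field; rewrite gt_eqF.
Qed.

Let MY_gt0 : 0 < l2norm MY.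
Proof.
rewrite lt_neqAle l2norm_ge0 andbT eq_sym; apply/eqP => /l2norm_eq0.
move=> /(_ (inr (Ordinal k0)))/= /eqP; rewrite gt_eqF//.
by rewrite !mulr_gt0// invr_gt0.
Qed.

Lemma card_separated_combinations_n : rademacher_type2 F tau -> 0 < tau ->
  (forall i i', i != i' ->
    8 * (tau * (M * Num.sqrt (c0 ^+ 2 * A ^+ 2 + B ^+ 2 / k%:R))) <
    `|\sum_j (w j ^+ 2 * alpha i j + beta i j) *: X j
      - \sum_j (w j ^+ 2 * alpha i' j + beta i' j) *: X j|) ->
  #|I|%:R <= 4 * (expR (rho ^+ 2 / c0 ^+ 2) * (2 * m%:R) ^+ k).
Proof.
move=> Ftau tau0 sep.
apply: (sampling_separation (tau := tau) (p := p) (Y := Y) (M := MY)) => //.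
- by rewrite mulr_gt0.
- exact: ltW.
- by rewrite card_prod card_bool card_ord muln_gt0 m0.
- move=> i i' ii'; rewrite !mean_p; apply: le_lt_trans (sep _ _ ii').
  by rewrite ler_wpM2l// ler_wpM2l// (ltW tau0).
Qed.

End separated_combinations.

(** The previous bound does not involve [n], so [n] is taken large enough to make all biases at most
    1. Passing to [|w j|] is harmless because only [w j ^+ 2] enters the combinations. *)
Lemma card_separated_combinations {R : realType} {F : normedModType R} {I : finType}
    {m : nat} (k : nat) (X : 'I_m -> F) (w : 'I_m -> R) (alpha beta : I -> 'I_m -> R)
    (tau M A rho B c0 : R) :
  (0 < m)%N -> (0 < k)%N -> 0 < B -> 0 < c0 -> 0 < M ->
  (forall j, `|X j| <= M) -> l2norm w <= A ->
  (forall i, l2norm (fun j => w j * alpha i j) <= rho) ->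
  (forall i, \sum_j `|beta i j| <= B) ->
  rademacher_type2 F tau -> 0 < tau ->
  (forall i i', i != i' ->
    8 * (tau * (M * Num.sqrt (c0 ^+ 2 * A ^+ 2 + B ^+ 2 / k%:R))) <
    `|\sum_j (w j ^+ 2 * alpha i j + beta i j) *: X j
      - \sum_j (w j ^+ 2 * alpha i' j + beta i' j) *: X j|) ->
  #|I|%:R <= 4 * (expR (rho ^+ 2 / c0 ^+ 2) * (2 * m%:R) ^+ k).
Proof.
move=> m0 k0 B0 c00 M0 XM wA arho betaB Ftau tau0 sep.
pose S := \sum_i \sum_j `|w j * alpha i j|.
have S0 : 0 <= S / c0.
  by rewrite divr_ge0 ?(ltW c00)//; do 2!(apply: sumr_ge0 => ? _).
pose n := (Num.bound (S / c0)).+1.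
have nS : S / c0 <= n%:R.
  rewrite (le_trans (ltW (archi_boundP S0)))// ler_nat.
  exact: leqnSn.
apply: (@card_separated_combinations_n _ _ _ _ n k X (fun j => `|w j|) alpha beta tau M A rho B c0) => //.
- by apply: le_trans wA; apply: l2norm_mono => j; rewrite normr_id.
- by move=> i; apply: le_trans (arho i); apply: l2norm_mono => j; rewrite !normrM normr_id.
- move=> i j; rewrite normrM normr_id -normrM.
  move: nS; rewrite ler_pdivrMr// mulrC; apply: le_trans.
  rewrite /S (bigD1 i)//= (bigD1 j)//= -addrA lerDl addr_ge0//.
    exact: sumr_ge0.
  by apply: sumr_ge0 => ? _; exact: sumr_ge0.
- move=> i i' ii'; under eq_bigr do rewrite real_normK ?num_real//.
  under [X in _ - X]eq_bigr do rewrite real_normK ?num_real//.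
  exact: sep.
Qed.

(** * Points separated for the metric of signed squares *)

Section cube_increment.
Context {R : realType}.
Implicit Types a b : R.

(** The increment of the cube is split at [|b - a| = |a|]. Below the threshold it is of order
    [a^2 |b - a|] and is written as [a^2] times a coefficient, to be sampled by biased signs; beyond
    it, it is of order [|b - a|^3] and is sampled by index. *)
Definition near_coef a b : R := if `|b - a| <= `|a| then (b ^+ 3 - a ^+ 3) / a ^+ 2 else 0.

Definition far_coef a b : R := if `|b - a| <= `|a| then 0 else b ^+ 3 - a ^+ 3.

Lemma cube_increment_split a b :
  a ^+ 2 * near_coef a b + far_coef a b = b ^+ 3 - a ^+ 3.
Proof.
rewrite /near_coef /far_coef; case: ifPn => [ab|_]; last by rewrite mulr0 add0r.
(* At [a = 0] the near case forces [b = 0], so the quotient by zero gives the correct value. *)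
have [a0|a0] := eqVneq a 0.
  move: ab; rewrite a0 normr0 normr_le0 subr0 => /eqP ->.
  by rewrite expr0n/= mul0r subrr addr0.
by rewrite addr0; field.
Qed.

Lemma cube_subE a b :
  b ^+ 3 - a ^+ 3 = (b - a) * (3 * a ^+ 2 + 3 * a * (b - a) + (b - a) ^+ 2).
Proof. by ring. Qed.

Lemma near_coef_le a b : `|a * near_coef a b| <= 7 * `|a * (a - b)|.
Proof.
rewrite /near_coef; case: ifPn => [ab|_]; last by rewrite mulr0 normr0 mulr_ge0.
have [->|a0] := eqVneq a 0; first by rewrite !mul0r normr0 mulr0.
have -> : a * ((b ^+ 3 - a ^+ 3) / a ^+ 2) = (b ^+ 3 - a ^+ 3) / a by field.
rewrite normrM normfV ler_pdivrMr ?normr_gt0// cube_subE !normrM.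
rewrite (distrC a b); set v := b - a in ab *.
rewrite (_ : 7 * (`|a| * `|v|) * `|a| = `|v| * (7 * `|a| ^+ 2)); last by ring.
rewrite ler_wpM2l// (le_trans (ler_normD _ _))//.
rewrite (le_trans (lerD (ler_normD _ _) (lexx _)))// !normrM ?normrX.
rewrite ger0_norm//; have := normr_ge0 v; have := normr_ge0 a; nra.
Qed.

Lemma far_coef_le a b : `|far_coef a b| <= 7 * `|a - b| ^+ 3.
Proof.
rewrite /far_coef; case: ifPn => [_|]; first by rewrite normr0 mulr_ge0// exprn_ge0.
rewrite -ltNge => ab; rewrite cube_subE normrM (distrC a b).
set v := b - a in ab *.
rewrite (_ : 7 * `|v| ^+ 3 = `|v| * (7 * `|v| ^+ 2)); last by ring.
rewrite ler_wpM2l// (le_trans (ler_normD _ _))//.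
rewrite (le_trans (lerD (ler_normD _ _) (lexx _)))// !normrM ?normrX.
rewrite ger0_norm//; have := normr_ge0 v; have := normr_ge0 a; nra.
Qed.

End cube_increment.

Section dual_facts.
Context {R : realType} {E : normedModType R}.

Lemma dual_norm_ge (Z : dual E) (y : E) : `|Z y : R| <= `|Z| * `|y|.
Proof. exact: dual_normP. Qed.

Lemma dual_sumE {m : nat} (X : 'I_m -> dual E) (c : 'I_m -> R) (y : E) :
  (\sum_j c j *: X j) y = \sum_j c j * X j y.
Proof.
exact: (big_morph (fun Z : dual E => (Z y : R)) (fun Z Z' => dualD Z Z' y) (erefl _)).
Qed.

End dual_facts.

(* Opaque, so that unification never unfolds the numeral. *)
Fact sep_const_subproof (R : realType) : {c : R | c = 784 * 256 * 256 * 256}.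
Proof. by exists (784 * 256 * 256 * 256). Qed.

Definition sep_const (R : realType) : R := sval (sep_const_subproof R).

Lemma sep_constE (R : realType) : sep_const R = 784 * 256 * 256 * 256.
Proof. exact: (svalP (sep_const_subproof R)). Qed.

Lemma sep_const_ge1 (R : realType) : 1 <= sep_const R.
Proof. by rewrite sep_constE; lra. Qed.

Section square_distance.
Context {R : realType} {E : normedModType R} {m : nat}.
Variable X : 'I_m -> dual E.

Definition evals (y : E) : 'I_m -> R := fun j => X j y.

Definition sqdist (y z : E) : R :=
  l2norm (fun j => ssqr (evals y j) - ssqr (evals z j)).

Lemma sqdist_ge0 y z : 0 <= sqdist y z. Proof. exact: l2norm_ge0. Qed.

Lemma sqdistC y z : sqdist y z = sqdist z y.
Proof.
by congr Num.sqrt; apply: eq_bigr => j _; rewrite -sqrrN opprB.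
Qed.

Lemma sqdistxx y : sqdist y y = 0.
Proof.
by rewrite /sqdist /l2norm big1 ?sqrtr0// => j _; rewrite subrr expr0n.
Qed.

Lemma sqdist_triangle x y z : sqdist x z <= sqdist x y + sqdist y z.
Proof.
apply: le_trans (l2normD _ _); apply: l2norm_mono => j /=.
by rewrite addrA subrK.
Qed.

Lemma evalsB y z j : evals (y - z) j = evals y j - evals z j.
Proof. by rewrite /evals linearB. Qed.

Lemma evals0 j : evals 0 j = 0.
Proof. by rewrite /evals linear0. Qed.

Lemma evalsZ (a : R) y j : evals (a *: y) j = a * evals y j.
Proof. by rewrite /evals linearZ. Qed.

Lemma sqdist_mid x y z :
  sqdist x (2^-1 *: (y + z)) <= sqdist x y + sqdist x z.
Proof.
apply: le_trans (_ : l2norm (fun j => `|ssqr (evals x j) - ssqr (evals y j)| +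
   `|ssqr (evals x j) - ssqr (evals z j)|) <= _).
  apply: l2norm_mono => j; rewrite [leRHS]ger0_norm ?addr_ge0//.
  have -> : evals (2^-1 *: (y + z)) j = 2^-1 * (evals y j + evals z j).
    by rewrite /evals linearZ linearD.
  exact: ssqr_mid.
apply: le_trans (l2normD _ _) _; apply: lerD; apply: l2norm_mono => j.
  by rewrite normr_id.
by rewrite normr_id.
Qed.

Variables (tau M A : R).
Hypotheses (tau0 : 0 < tau) (M0 : 0 < M) (A0 : 0 < A).
Hypothesis Etau : rademacher_type2 (dual E) tau.
Hypothesis XM : forall j, `|X j| <= M.
Hypothesis XA : forall y, `|y| <= 1 -> l2norm (evals y) <= A.

Lemma l2norm_evals y : l2norm (evals y) <= A * `|y|.
Proof.
have [->|y0] := eqVneq y 0.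
  rewrite normr0 mulr0 /l2norm big1 ?sqrtr0// => j _.
  by rewrite evals0 expr0n.
have y1 : 0 < `|y| by rewrite normr_gt0.
rewrite -ler_pdivrMr// mulrC -l2normZ ?invr_ge0//.
apply: le_trans (XA (y := `|y|^-1 *: y) _).
  by apply: l2norm_mono => j; rewrite evalsZ.
by rewrite normrZ normfV normr_id mulVf ?gt_eqF.
Qed.

(** Each [z i] is encoded by the functional whose coefficients are the increments of the cubes from
    [z0] to [z i]. Separation in [sqdist] becomes separation of these functionals in norm, and
    [card_separated_combinations] counts them. *)
Lemma card_sqdist_separated (I : finType) (k : nat) (z : I -> E) (z0 : E) (r d : R) :
  (0 < m)%N -> (0 < k)%N -> 0 < r -> 0 < d -> `|z0| <= 1 ->
  (forall i, `|z i - z0| <= r) -> (forall i i', `|z i - z i'| <= r) ->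
  (forall i, sqdist (z i) z0 <= 2 * d) ->
  (forall i i', i != i' -> d / 8 < sqdist (z i) (z i')) ->
  sep_const R * (tau * M * A) ^+ 2 * r ^+ 4 / d ^+ 2 <= k%:R ->
  #|I|%:R <= 4 * (expR (sep_const R * (tau * M * A) ^+ 2 * r ^+ 2 / d ^+ 2)
                 * (2 * m%:R) ^+ k).
Proof.
rewrite sep_constE => m0 k0 r0 d0 z01 zr zrr zd zsep kbig.
(* [e] is [(d / 8)^2 / (4 r)], the lower bound obtained for the distance of two functionals. [B] is
   [7 (A r) (4 d)], from Cauchy-Schwarz on the cubed differences. [c0] makes [c0 * A] a sixteenth of
   [e / (tau * M)]. *)
pose e := d ^+ 2 / (256 * r).
pose B := 28 * A * r * d.
pose c0 := e / (16 * tau * M * A).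
pose w := evals z0.
pose alpha i j := near_coef (w j) (evals (z i) j).
pose beta i j := far_coef (w j) (evals (z i) j).
have e0 : 0 < e by rewrite divr_gt0 ?mulr_gt0 ?exprn_gt0.
have B0 : 0 < B by rewrite !mulr_gt0.
have c00 : 0 < c0 by apply: divr_gt0 => //; rewrite !mulr_gt0.
have -> : 784 * 256 * 256 * 256 * (tau * M * A) ^+ 2 * r ^+ 2 / d ^+ 2 =
    (28 * d) ^+ 2 / c0 ^+ 2 :> R.
  by rewrite /c0 /e; field; rewrite !gt_eqF.
have kR : 0 < k%:R :> R by rewrite ltr0n.
apply: (@card_separated_combinations _ _ _ _ k X w alpha beta tau M A (28 * d) B c0) => //.
- exact: XA.
- move=> i; apply: (@le_trans _ _ (14 * sqdist (z i) z0)); last first.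
    by have := zd i; lra.
  rewrite sqdistC -l2normZ//; apply: l2norm_mono => j.
  rewrite (le_trans (near_coef_le _ _))// [leRHS]normrM (ger0_norm (_ : 0 <= 14))//.
  by have := norm_mul_sub_le_ssqr (w j) (evals (z i) j); rewrite -/w; lra.
- move=> i; pose v j := `|w j - evals (z i) j|.
  apply: (@le_trans _ _ (\sum_j 7 * (v j * v j ^+ 2))).
    by apply: ler_sum => j _; rewrite -exprS far_coef_le.
  rewrite -mulr_sumr.
  have := cauchy_schwarz v (fun j => v j ^+ 2).
  have v1 : l2norm v <= A * r.
    apply: (@le_trans _ _ (l2norm (evals (z i - z0)))).
      by apply: l2norm_mono => j; rewrite evalsB normr_id distrC.
    by rewrite (le_trans (l2norm_evals _))// ler_wpM2l// ltW.
  have v2 : l2norm (fun j => v j ^+ 2) <= 4 * d.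
    apply: (@le_trans _ _ (2 * sqdist (z i) z0)); last by have := zd i; lra.
    rewrite sqdistC -l2normZ//; apply: l2norm_mono => j.
    rewrite real_normK ?num_real// ger0_norm ?sqr_ge0// [leRHS]normrM (ger0_norm (_ : 0 <= 2))//.
    exact: sqr_sub_le2_ssqr.
  have := ler_pM (l2norm_ge0 _) (l2norm_ge0 _) v1 v2.
  by rewrite /B => *; lra.
- move=> i i' ii'.
  pose b i := \sum_j (w j ^+ 2 * alpha i j + beta i j) *: X j.
  (* Both terms under the root are at most [(e / (tau * M))^2 / 256], and [2 / 256 <= 1 / 100]. The
     required separation is then at most [4 e / 5], below [e]. *)
  have sq : Num.sqrt (c0 ^+ 2 * A ^+ 2 + B ^+ 2 / k%:R) <= e / (10 * tau * M).
    rewrite -[leRHS]ger0_norm; last by apply: divr_ge0; [exact: ltW|rewrite !mulr_ge0 ?ltW].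
    rewrite -sqrtr_sqr ler_wsqrtr//.
    have -> : c0 ^+ 2 * A ^+ 2 = (e / (tau * M)) ^+ 2 / 256.
      by rewrite /c0; field; rewrite !gt_eqF.
    have -> : (e / (10 * tau * M)) ^+ 2 = (e / (tau * M)) ^+ 2 / 100.
      by field; rewrite !gt_eqF.
    suff : B ^+ 2 / k%:R <= (e / (tau * M)) ^+ 2 / 256.
      by have := sqr_ge0 (e / (tau * M)); lra.
    rewrite ler_pdivrMr// mulrC -ler_pdivrMr; last first.
      by rewrite divr_gt0// exprn_gt0// divr_gt0// mulr_gt0.
    apply: le_trans kbig; rewrite le_eqVlt; apply/orP; left; apply/eqP.
    by rewrite /B /e; field; rewrite !gt_eqF.
  (* The difference of the two functionals is evaluated at [z i - z i'], and [ssqr_sub_sqr_le] is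
     applied in each coordinate. *)
  have be : e <= `|b i - b i'|.
    have := dual_norm_ge (b i - b i') (z i - z i').
    have := ler_norm ((b i - b i') (z i - z i') : R).
    have -> : (b i - b i') (z i - z i') =
      \sum_j (evals (z i) j ^+ 3 - evals (z i') j ^+ 3) * (evals (z i) j - evals (z i') j) :> R.
      rewrite /b -sumrB; under eq_bigr do rewrite -scalerBl.
      rewrite dual_sumE; apply: eq_bigr => j _.
      rewrite !cube_increment_split (evalsB _ _ j : X j _ = _ :> R); congr *%R; ring.
    move=> h1 h2.
    have h3 : sqdist (z i) (z i') ^+ 2 <= 4 * (`|b i - b i'| * r).
      rewrite /sqdist l2norm_sqr (le_trans (ler_sum _ (fun j _ => ssqr_sub_sqr_le _ _)))//.
      rewrite -mulr_sumr ler_wpM2l// (le_trans h1)// (le_trans h2)//.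
      by rewrite ler_wpM2l.
    have h4 : (d / 8) ^+ 2 <= sqdist (z i) (z i') ^+ 2.
      by rewrite lerXn2r ?nnegrE ?sqdist_ge0// ?ltW ?divr_gt0// zsep.
    rewrite /e ler_pdivrMr ?mulr_gt0//.
    have -> : d ^+ 2 = 64 * (d / 8) ^+ 2 by field.
    lra.
  apply: lt_le_trans be.
  apply: (@le_lt_trans _ _ (8 * (tau * (M * (e / (10 * tau * M)))))).
    by rewrite !ler_wpM2l// ltW.
  have -> : 8 * (tau * (M * (e / (10 * tau * M)))) = e * (4 / 5).
    by field; rewrite !gt_eqF.
  by lra.
Qed.

End square_distance.

(** * Interpolation *)

Section interpolation.
Local Open Scope classical_set_scope.
Context {R : realType} {E : normedModType R} {m : nat}.
Variable X : 'I_m -> dual E.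
Local Notation D := (sqdist X).

Definition K_values (t : R) (x : E) : set R :=
  [set `|u| ^+ 2 + t * D x u | u in unit_ball E].

Definition K_functional (t : R) (x : E) : R := inf (K_values t x).

Lemma K_values_has_inf t x : 0 <= t -> has_inf (K_values t x).
Proof.
move=> t0; split; first by eexists; exists 0 => //; rewrite /unit_ball/= normr0.
by exists 0 => _ [u _ <-]; rewrite addr_ge0 ?sqr_ge0// mulr_ge0// sqdist_ge0.
Qed.

Lemma K_functional_le t x u : 0 <= t -> `|u| <= 1 ->
  K_functional t x <= `|u| ^+ 2 + t * D x u.
Proof.
move=> t0 u1; apply: inf_lbound; last by exists u.
by case: (K_values_has_inf x t0).
Qed.

Lemma K_functional_approx t x eta : 0 <= t -> 0 < eta ->
  exists u, `|u| <= 1 /\ `|u| ^+ 2 + t * D x u < K_functional t x + eta.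
Proof.
by move=> t0 e0; have [_ [u u1 <-] h] := inf_adherent e0 (K_values_has_inf x t0); exists u.
Qed.

Lemma K_functional_le1 t x : 0 <= t -> `|x| <= 1 -> K_functional t x <= 1.
Proof.
move=> t0 x1; apply: le_trans (K_functional_le x t0 x1) _.
by rewrite sqdistxx mulr0 addr0 expr_le1.
Qed.

Lemma mid_norm_le1 (y z : E) : `|y| <= 1 -> `|z| <= 1 -> `|2^-1 *: (y + z)| <= 1.
Proof.
move=> y1 z1; rewrite normrZ ger0_norm ?invr_ge0//.
by have := ler_normD y z; lra.
Qed.

(* Test both K-functionals at the midpoint of the two near-minimizers. *)
Lemma near_minimizers_close (lambda t eta : R) (x y z w : E) :
  0 < lambda -> convex_power_type2 E lambda -> 0 <= t ->
  `|z| <= 1 -> `|w| <= 1 ->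
  `|z| ^+ 2 + t * D x z <= K_functional t x + eta ->
  `|w| ^+ 2 + t * D y w <= K_functional t y + eta ->
  `|z - w| ^+ 2 <= 4 * lambda ^+ 2 * (eta + t * (D x z + D y w + D x y)).
Proof.
move=> l0 cvx t0 z1 w1 hz hw.
pose u := 2^-1 *: (z + w).
have u1 := mid_norm_le1 z1 w1.
have := K_functional_le x t0 u1; have := K_functional_le y t0 u1 => hy hx.
have := cvx z w; rewrite [`|2^-1 *: (z - w)|]normrZ (@ger0_norm _ 2^-1) ?invr_ge0//.
have -> : lambda ^- 2 * (2^-1 * `|z - w|) ^+ 2 = `|z - w| ^+ 2 / lambda ^+ 2 / 4.
  by field; rewrite gt_eqF.
move=> hc.
have txu : t * D x u <= t * (D x z + (D x y + D y w)).
  by rewrite ler_wpM2l// (le_trans (sqdist_mid _ _ _ _))// lerD2l sqdist_triangle.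
have tyu : t * D y u <= t * (D x y + D x z + D y w).
  rewrite ler_wpM2l// (le_trans (sqdist_mid _ _ _ _))// lerD2r (sqdistC _ x y).
  exact: sqdist_triangle.
have tz : 0 <= t * D x z by rewrite mulr_ge0// sqdist_ge0.
have tw : 0 <= t * D y w by rewrite mulr_ge0// sqdist_ge0.
have : `|z - w| ^+ 2 / lambda ^+ 2 <= 4 * (eta + t * (D x z + D y w + D x y)).
  rewrite -/u in hc; lra.
by rewrite ler_pdivrMr ?exprn_gt0//; lra.
Qed.

(** [pi n x] is a point whose value is within [eta] of the infimum [K_functional] at
    [t = 2 ^+ n * t0]; the infimum need not be attained. The sum stays bounded because the
    functional is at most 1 on the unit ball. *)
Lemma interpolation (lambda t0 eta : R) :
  0 < lambda -> convex_power_type2 E lambda -> 0 < t0 -> 0 < eta ->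
  exists pi : nat -> E -> E,
  [/\ forall n x, `|pi n x| <= 1,
      forall n x y, `|pi n x - pi n y| ^+ 2 <=
        4 * lambda ^+ 2 * (eta + 2 ^+ n * t0 * (D x (pi n x) + D y (pi n y) + D x y)) &
      forall N x, `|x| <= 1 ->
        \sum_(n < N) 2 ^+ n * t0 * D x (pi n x) <= 2 * (1 + N%:R * eta)].
Proof.
move=> l0 cvx t00 eta0.
have t_ge0 n : 0 <= 2 ^+ n * t0 by rewrite mulr_ge0 ?exprn_ge0// ltW.
have /choice[f fP] : forall nx : nat * E, exists u, `|u| <= 1 /\
    `|u| ^+ 2 + 2 ^+ nx.1 * t0 * D nx.2 u < K_functional (2 ^+ nx.1 * t0) nx.2 + eta.
  by move=> [n x]; exact: K_functional_approx.
exists (fun n x => f (n, x)); split.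
- by move=> n x; case: (fP (n, x)).
- move=> n x y; have [z1 /ltW hz] := fP (n, x); have [w1 /ltW hw] := fP (n, y).
  exact: near_minimizers_close.
move=> N x x1; set s := fun n => D x (f (n, x)).
(* The near-minimizer at level [n + 1] also competes at level [n], where [t] is half as large. Hence
   [t_(n+1) s_(n+1) <= 2 (K(t_(n+1)) - K(t_n) + eta)], and the sum telescopes. *)
have key n : \sum_(i < n.+1) 2 ^+ i * t0 * s i
    <= 2 * (K_functional (2 ^+ n * t0) x + n.+1%:R * eta).
  elim: n => [|n IH].
    rewrite big_ord1; have [_ /ltW /=] := fP (0%N, x); rewrite -/(s 0%N) expr0 !mul1r.
    have := sqr_ge0 `|f (0%N, x)|.
    have : 0 <= t0 * s 0%N by rewrite mulr_ge0 ?sqdist_ge0// ltW.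
    by lra.
  rewrite big_ord_recr/=; have [u1 /ltW /=] := fP (n.+1, x); rewrite -/(s n.+1).
  have := K_functional_le x (t_ge0 n) u1; rewrite -/(s n.+1).
  rewrite (exprS 2 n) -(natr1 n.+1); move: IH; set S := \sum_(_ < _) _.
  set p := 2 ^+ n; lra.
case: N => [|N].
  by rewrite big_ord0 mul0r; lra.
apply: le_trans (key N) _; rewrite ler_pM2l// lerD2r.
exact: K_functional_le1.
Qed.

End interpolation.

(** * Chaining *)

Section rademacher_sums.
Context {R : realType} {I : finType}.
Implicit Types (u : I -> R) (s : {ffun I -> bool}).

Definition rademacher_sum u s : R := \sum_i (-1) ^+ s i * u i.

(* The bound doubles its range of validity via cosh x = 2 cosh^2 (x/2) - 1. *)
Lemma cosh_le (x : R) : expR x + expR (- x) <= 2 * expR (2 * x ^+ 2).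
Proof.
have base (y : R) : `|y| <= 2^-1 -> expR y + expR (- y) <= 2 * expR (2 * y ^+ 2).
  have small (z : R) : `|z| <= 2^-1 -> expR z <= 1 + z + 2 * z ^+ 2.
    rewrite ler_norml => /andP[z1 z2]; rewrite -[z in expR z]opprK expRN.
    have z0 : 0 < 1 - z by lra.
    have h := expR_ge1Dx (- z).
    rewrite -[leLHS]mul1r ler_pdivrMr ?expR_gt0//.
    have p0 : 0 <= 1 + z + 2 * z ^+ 2 by nra.
    apply: le_trans (ler_wpM2l p0 h).
    by have : 0 <= z ^+ 2 * (1 - 2 * z) by [rewrite mulr_ge0 ?sqr_ge0//; lra]; lra.
  move=> yb; have := small y yb; have := small (- y); rewrite normrN sqrrN => /(_ yb).
  by have := expR_ge1Dx (2 * y ^+ 2); lra.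
have step n : forall y : R, `|y| <= 2^-1 * 2 ^+ n ->
    expR y + expR (- y) <= 2 * expR (2 * y ^+ 2).
  elim: n => [|n IH] y; first by rewrite expr0 mulr1; exact: base.
  rewrite exprS => yb; have := IH (y / 2).
  rewrite normrM (ger0_norm (_ : 0 <= 2^-1))// => /(_ _); rewrite -mulNr.
  have -> : 2 * (y / 2) ^+ 2 = y ^+ 2 / 2 by field.
  have h : `|y| / 2 <= 2^-1 * 2 ^+ n by lra.
  move/(_ h) => {h}.
  have -> : expR y = expR (y / 2) ^+ 2 by rewrite -expRM_natl; congr expR; field.
  have -> : expR (- y) = expR (- y / 2) ^+ 2 by rewrite -expRM_natl; congr expR; field.
  have -> : expR (2 * y ^+ 2) = (expR (y ^+ 2 / 2) ^+ 2) ^+ 2.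
    by rewrite -!expRM_natl; congr expR; field.
  have : expR (y / 2) * expR (- y / 2) = 1.
    by rewrite -expRD mulNr subrr expR0.
  have := expR_gt0 (y / 2); have := expR_gt0 (- y / 2).
  have : 1 <= expR (y ^+ 2 / 2).
    apply: le_trans (expR_ge1Dx _); have := sqr_ge0 y; lra.
  set u := expR (y ^+ 2 / 2); set p := expR (y / 2); set q := expR _.
  move=> u1 q0 p0 pq pqu.
  have h1 : (p + q) ^+ 2 <= (2 * u) ^+ 2 by rewrite lerXn2r ?nnegrE//; lra.
  have h2 : 0 <= (u ^+ 2 - 1) ^+ 2 by exact: sqr_ge0.
  by nra.
have [n xn] : exists n, `|x| <= 2^-1 * 2 ^+ n.
  exists (Num.bound `|x|).+1; rewrite exprS mulrA mulVf// mul1r.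
  rewrite (le_trans (ltW (archi_boundP _)))// -natrX ler_nat ltnW//.
  exact: ltn_expl.
exact: step xn.
Qed.

Lemma rademacher_mgf u :
  \sum_s expR (rademacher_sum u s) <= 2 ^+ #|I| * expR (2 * l2norm u ^+ 2).
Proof.
rewrite /rademacher_sum; under eq_bigr do rewrite expR_sum.
rewrite -(bigA_distr_bigA (fun i (b : bool) => expR ((-1) ^+ b * u i)))/=.
rewrite l2norm_sqr mulr_sumr expR_sum -prodr_const -big_split/=; apply: ler_prod => i _; rewrite big_bool/=.
rewrite expr1 expr0 mul1r mulN1r addr_ge0 ?expR_ge0//= addrC.
exact: cosh_le.
Qed.

(** Exponential moments with [max 0 z <= h^-1 exp (h z)]. The choice [h = c / 4] minimizes
    [2 h^2 - h c], with minimum [- c^2 / 8]. *)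
Lemma rademacher_excess u (d c : R) : 0 < d -> 0 < c -> l2norm u <= d ->
  \sum_s Num.max 0 (`|rademacher_sum u s| / d - c)
  <= 2 ^+ #|I| * (8 / c * expR (- (c ^+ 2 / 8))).
Proof.
move=> d0 c0 ud; pose h := c / 4; have h0 : 0 < h by rewrite divr_gt0.
have key (e : R) : `|e| = 1 ->
    \sum_s expR (h / d * (e * rademacher_sum u s)) <= 2 ^+ #|I| * expR (c ^+ 2 / 8).
  move=> e1.
  have -> : \sum_s expR (h / d * (e * rademacher_sum u s)) =
      \sum_s expR (rademacher_sum (fun i => h / d * e * u i) s).
    apply: eq_bigr => s _; congr expR; rewrite !mulrA mulr_sumr.
    by apply: eq_bigr => i _; ring.
  apply: le_trans (rademacher_mgf _) _; rewrite ler_wpM2l ?exprn_ge0// ler_expR.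
  rewrite (_ : c ^+ 2 / 8 = 2 * h ^+ 2); last by rewrite /h; field.
  rewrite ler_pM2l// lerXn2r ?nnegrE ?l2norm_ge0// ?(ltW h0)//.
  apply: (@le_trans _ _ (l2norm (fun i => h / d * u i))).
    by apply: l2norm_mono => i; rewrite !normrM e1 mulr1.
  rewrite l2normZ; last by apply: divr_ge0; exact: ltW.
  by rewrite mulrAC ler_pdivrMr// ler_wpM2l// ltW.
have k1 := key 1 (normr1 _); have k2 := key (-1) (normrN1 _).
apply: (@le_trans _ _ (\sum_s (h^-1 * expR (- (h * c))) *
   (expR (h / d * (1 * rademacher_sum u s)) + expR (h / d * (-1 * rademacher_sum u s))))).
  apply: ler_sum => s _; set x := rademacher_sum u s.
  apply: (@le_trans _ _ (h^-1 * expR (h * (`|x| / d - c)))).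
    rewrite ge_max mulr_ge0 ?invr_ge0 ?expR_ge0// ?(ltW h0)//=.
    by rewrite ler_pdivlMl//; apply: le_trans (expR_ge1Dx _); lra.
  rewrite -mulrA ler_wpM2l ?invr_ge0 ?(ltW h0)//.
  rewrite (_ : h * (_ - _) = - (h * c) + h / d * `|x|); last by ring.
  rewrite expRD ler_wpM2l ?expR_ge0//.
  have := expR_ge0 (h / d * (1 * x)); have := expR_ge0 (h / d * (-1 * x)).
  by case: (ger0P x) => _; rewrite ?mul1r ?mulN1r => *; lra.
rewrite -mulr_sumr big_split/=.
apply: (@le_trans _ _ (h^-1 * expR (- (h * c)) * (2 ^+ #|I| * expR (c ^+ 2 / 8) * 2))).
  by rewrite ler_wpM2l ?mulr_ge0 ?invr_ge0 ?expR_ge0// ?(ltW h0)//; lra.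
have -> : - (c ^+ 2 / 8) = - (h * c) + c ^+ 2 / 8 by rewrite /h; field.
rewrite expRD le_eqVlt; apply/orP; left; apply/eqP.
by rewrite /h; field; rewrite gt_eqF.
Qed.

End rademacher_sums.

Section chaining.
Context {R : realType} {I T : finType}.
Implicit Types (s : {ffun I -> bool}).

(** An arbitrary selection [sel] of a point for each sign pattern stands for the supremum. Every
    link exceeds its typical size by a multiple of an excess [e]; the total excess [ex s] over all
    links of all levels has mean at most 2 and serves all points at once. *)
Lemma chaining (a : T -> I -> R) (d : T -> T -> R) (x0 : T) (N : nat)
    (c : nat -> T -> T) (l K Gamma : R) (sel : {ffun I -> bool} -> T) :
  2^-1 <= l -> 0 <= K ->
  (forall i, a x0 i = 0) -> (forall x, c 0%N x = x0) -> (forall x, c N x = x) ->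
  (forall n x, (n < N)%N -> c n (c n.+1 x) = c n x) ->
  (forall n, (n <= N)%N -> #|[set c n x | x : T]%SET|%:R <= expR (K * (4 ^+ n * l))) ->
  (forall x x', l2norm (fun i => a x i - a x' i) <= d x x') ->
  (forall x, \sum_(n < N) 2 ^+ n * Num.sqrt l * d (c n.+1 x) (c n x) <= Gamma) ->
  \sum_s `|rademacher_sum (a (sel s)) s|
  <= 2 ^+ #|I| * ((Num.sqrt (32 * K + 64) + 4) * Gamma).
Proof.
move=> l2 K0 a0 c0 cN cc cK ad Gam.
pose g n : R := 2 ^+ n * Num.sqrt l.
(* With this value [(L g_n)^2 / 8] equals [(4 K + 8) 4^n l], which beats the exponent [4 K 4^n l] in
   the number of points of level [n + 1]. *)
pose L := Num.sqrt (32 * K + 64).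
have g2 n : g n ^+ 2 = 4 ^+ n * l.
  rewrite exprMn sqr_sqrtr; last by lra.
  by rewrite (_ : 4 = 2 ^+ 2 :> R); [rewrite -!exprM mulnC|ring].
have sl : 2^-1 <= Num.sqrt l.
  rewrite -[leLHS]ger0_norm// -sqrtr_sqr ler_wsqrtr//.
  by rewrite (le_trans _ l2)//; lra.
have ghalf n : 2^-1 <= g n.
  rewrite (le_trans sl)// ler_peMl ?(le_trans _ sl)//.
  by rewrite exprn_ege1// ler1n.
have g0 n : 0 < g n by rewrite (lt_le_trans _ (ghalf n)).
have L2 : 8 <= L.
  rewrite -[leLHS]ger0_norm// -sqrtr_sqr ler_wsqrtr//; lra.
have L0 : 0 < L by rewrite (lt_le_trans _ L2).
have d0 x x' : 0 <= d x x' := le_trans (l2norm_ge0 _) (ad x x').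
pose xi n b s := `|rademacher_sum (fun i => a b i - a (c n b) i) s|.
pose e n b s : R := Num.max 0 (xi n b s / d b (c n b) - L * g n).
pose ex s : R := \sum_(n < N) \sum_(b in [set c n.+1 x | x : T]%SET) e n b s.
have e0 n b s : 0 <= e n b s by rewrite le_max lexx.
have xi_le n b s : xi n b s <= d b (c n b) * (L * g n + e n b s).
  (* At distance 0 the increment itself vanishes, so the quotient by zero inside [e] does no
     harm. *)
  have [db|db] := eqVneq (d b (c n b)) 0.
    rewrite db mul0r /xi /rademacher_sum big1 ?normr0// => i _.
    rewrite (@l2norm_eq0 _ _ (fun i => a b i - a (c n b) i)) ?mulr0//.
    by apply/eqP; rewrite eq_le l2norm_ge0 andbT -db ad.
  have {}db : 0 < d b (c n b) by rewrite lt_neqAle eq_sym db d0.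
  rewrite -ler_pdivrMl// mulrC -lerBlDl.
  by rewrite le_max lexx orbT.
have e_sum n b : \sum_s e n b s <= 2 ^+ #|I| * (8 / (L * g n) * expR (- ((L * g n) ^+ 2 / 8))).
  have [db|db] := eqVneq (d b (c n b)) 0.
    rewrite big1; first by rewrite mulr_ge0 ?exprn_ge0// mulr_ge0 ?expR_ge0// divr_ge0// mulr_ge0// ltW.
    move=> s _; rewrite /e db invr0 mulr0 sub0r; apply/max_idPl.
    by rewrite oppr_le0 mulr_ge0// ltW.
  have {}db : 0 < d b (c n b) by rewrite lt_neqAle eq_sym db d0.
  by apply: rademacher_excess => //; rewrite mulr_gt0.
(* Level [n] contributes at most [2 * 2^-(n+1)]: the factor [8 / (L g_n)] is at most 2, and the
   count is absorbed by the exponential. *)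
have ex_sum : \sum_s ex s <= 2 ^+ #|I| * 2.
  rewrite /ex exchange_big/=.
  apply: (@le_trans _ _ (\sum_(n < N) 2 ^+ #|I| * (2 * 2^-1 ^+ n.+1))).
    apply: ler_sum => n _; rewrite exchange_big/=.
    apply: (le_trans (ler_sum _ (fun b _ => e_sum n b))).
    rewrite sumr_const -[leLHS]mulr_natl mulrCA ler_wpM2l ?exprn_ge0//.
    have := cK n.+1 (ltn_ord n); set q := #|_|%:R => hq.
    have h1 : 8 / (L * g n) <= 2.
      rewrite ler_pdivrMr ?(mulr_gt0 L0 (g0 n))//.
      by have := ghalf n; nra.
    have h2 : q * expR (- ((L * g n) ^+ 2 / 8)) <= 2^-1 ^+ n.+1.
      apply: (@le_trans _ _ (expR (- (4 * (4 ^+ n * l))))).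
        apply: (@le_trans _ _ (expR (K * (4 ^+ n.+1 * l)) * expR (- ((L * g n) ^+ 2 / 8)))).
          by rewrite ler_wpM2r// expR_ge0.
        rewrite -expRD ler_expR exprMn g2 sqr_sqrtr; last by lra.
        have : 0 <= 4 ^+ n * l by rewrite -g2 sqr_ge0.
        by rewrite exprS; lra.
      rewrite expRN exprVn lef_pV2 ?posrE ?exprn_gt0 ?expR_gt0//.
      apply: le_trans (expR_ge1Dx _).
      have h4 : 2 ^+ n <= 4 ^+ n :> R by rewrite lerXn2r ?nnegrE// ler_nat.
      have h5 : 0 <= 2 ^+ n :> R by rewrite exprn_ge0.
      by rewrite exprS; nra.
    have e1 := expR_ge0 (- ((L * g n) ^+ 2 / 8)).
    have q0 : 0 <= q by rewrite ler0n.
    rewrite mulrCA; apply: ler_pM => //; first by rewrite divr_ge0// mulr_ge0// ltW.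
    by rewrite mulr_ge0.
  rewrite -mulr_sumr ler_wpM2l ?exprn_ge0// -mulr_sumr ler_piMr//.
  suff -> : \sum_(n < N) 2^-1 ^+ n.+1 = 1 - 2^-1 ^+ N :> R.
    by rewrite gerBl exprn_ge0// invr_ge0.
  elim: (N) => [|k IH]; first by rewrite big_ord0 expr0 subrr.
  by rewrite big_ord_recr/= IH exprS; field.
have VE x s : `|rademacher_sum (a x) s| <= Gamma * (L + 2 * ex s).
  have -> : rademacher_sum (a x) s =
      \sum_(n < N) rademacher_sum (fun i => a (c n.+1 x) i - a (c n x) i) s.
    have := telescope_sumr (fun n => rademacher_sum (a (c n x)) s) (leq0n N).
    rewrite cN c0 [X in _ - X]big1 ?subr0 => [<-|i _]; last by rewrite a0 mulr0.
    rewrite big_mkord; apply: eq_bigr => n _.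
    by rewrite -sumrB; apply: eq_bigr => i _; ring.
  apply: le_trans (ler_norm_sum _ _ _) _.
  apply: (@le_trans _ _ (\sum_(n < N) (g n * d (c n.+1 x) (c n x)) * (L + 2 * ex s))).
    apply: ler_sum => n _.
    have := xi_le n (c n.+1 x) s; rewrite /xi (cc n x (ltn_ord n)); move/le_trans; apply.
    rewrite [g n * _]mulrC -mulrA ler_wpM2l// mulrDr (mulrC L) lerD2l.
    apply: (@le_trans _ _ (ex s)).
      rewrite /ex (bigD1 n)//= (bigD1 (c n.+1 x))/=; last by apply/imsetP; exists x.
      rewrite -addrA lerDl addr_ge0//; first exact: sumr_ge0.
      by apply: sumr_ge0 => ? _; exact: sumr_ge0.
    (* Since [g n >= 1/2], the excess is at most [g n * (2 * ex s)], which makes [g n] a common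
       factor. *)
    have : 0 <= ex s by do 2!(apply: sumr_ge0 => ? _).
    by have := ghalf n; nra.
  rewrite -mulr_suml ler_wpM2r//.
  by rewrite addr_ge0 ?(ltW L0)// mulr_ge0//; do 2!(apply: sumr_ge0 => ? _).
apply: (@le_trans _ _ (\sum_s Gamma * (L + 2 * ex s))).
  by apply: ler_sum => s _; exact: VE.
have Gam0 : 0 <= Gamma.
  by apply: le_trans (Gam x0); apply: sumr_ge0 => n _; rewrite mulr_ge0// ltW.
rewrite -mulr_sumr big_split/= sumr_const -mulr_sumr card_ffun card_bool.
rewrite -[X in _ * (X + _)]mulr_natl natrX.
set p := 2 ^+ _ in ex_sum *.
rewrite [leRHS](_ : _ = Gamma * (p * L + 2 * (p * 2))); last by rewrite -/L; ring.
by rewrite ler_wpM2l//; lra.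
Qed.

End chaining.

(** * Refining partitions *)

(** A maximal subset of [S] without close pairs must have a member close to every point of [S]; [f]
    chooses one. *)
Lemma separated_net (T : finType) (close : rel T) (S : {set T}) :
  reflexive close -> symmetric close ->
  exists f : T -> T,
    (forall x, x \in S -> f x \in S /\ close x (f x)) /\
    (forall b b', b \in f @: S -> b' \in f @: S -> b != b' -> ~~ close b b').
Proof.
move=> cxx cC.
pose P (B : {set T}) := (B \subset S) &&
  [forall b in B, forall b' in B, (b != b') ==> ~~ close b b'].
have P0 : exists B, P B.
  by exists finset.set0; rewrite /P finset.sub0set; apply/forallP => b; rewrite finset.in_set0.
have [B /maxsetP[/andP[BS /forall_inP Bsep] Bmax]] := ex_maxset P0.
have cover x : x \in S -> exists b, (b \in B) && close x b.
  move=> xS; apply/existsP; apply: contraT => /existsPn nc.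
  have xB : x \in B.
    have <- : x |: B = B; last by rewrite finset.setU11.
    apply: Bmax; last exact: finset.subsetUr.
    rewrite /P finset.subUset finset.sub1set xS BS/=; apply/forall_inP => b bB; apply/forall_inP => b' b'B.
    move: bB b'B; rewrite !inE => /predU1P[->|bB] /predU1P[->|b'B].
    - by rewrite eqxx.
    - by apply/implyP => _; have := nc b'; rewrite b'B.
    - by apply/implyP => _; have := nc b; rewrite bB cC.
    - by have /forall_inP/(_ _ b'B) := Bsep _ bB.
  by have := nc x; rewrite xB cxx.
pose f x := odflt x [pick b in B | close x b].
have fP x : x \in S -> f x \in B /\ close x (f x).
  move=> /cover[b bB]; rewrite /f; case: pickP => [b' /andP[]//|/(_ b)].
  by rewrite bB.
exists f; split=> [x xS|b b'].
  by have [fB cf] := fP x xS; split => //; exact: (fintype.subsetP BS).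
move=> /imsetP[x xS ->] /imsetP[x' x'S ->].
have [fB _] := fP x xS; have [fB' _] := fP x' x'S.
by have /forall_inP/(_ _ fB')/implyP := Bsep _ fB.
Qed.

(** * Partitions adapted to the interpolation *)

Section partition.
Context {R : realType} {E : normedModType R} {m : nat} {T : finType}.
Variables (X : 'I_m -> dual E) (tau M A lambda eta : R) (N : nat).
Variables (y : T -> E) (x0 : T) (pi : nat -> E -> E).
Hypothesis m2 : (2 <= m)%N.
Hypotheses (tau0 : 0 < tau) (M0 : 0 < M) (A0 : 0 < A) (lambda1 : 1 <= lambda).
Hypothesis Etau : rademacher_type2 (dual E) tau.
Hypothesis XM : forall j, `|X j| <= M.
Hypothesis XA : forall v, `|v| <= 1 -> l2norm (evals X v) <= A.
Hypothesis y1 : forall x, `|y x| <= 1.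
Hypothesis y0 : y x0 = 0.

Local Notation l := (ln (m%:R : R)).
Let kap := tau * M * A.
(** The scales are matched so that [(2 ^+ n * t0) * r n * l = 1]; [r n] is the resolution of level
    [n] in the metric [sqdist]. *)
Let t0 := (kap * lambda ^+ 2)^-1.
Let r n : R := kap * lambda ^+ 2 / (2 ^+ n * l).
Let D x x' := sqdist X (y x) (y x').
Let s n x := sqdist X (y x) (pi n (y x)).

Hypotheses (etal : eta * l <= 1) (etaN : N%:R * eta <= 1).
Hypothesis pi1 : forall n v, `|pi n v| <= 1.
Hypothesis pi_close : forall n v v', `|pi n v - pi n v'| ^+ 2 <=
  4 * lambda ^+ 2 * (eta + 2 ^+ n * t0 *
    (sqdist X v (pi n v) + sqdist X v' (pi n v') + sqdist X v v')).
Hypothesis pi_sum : forall N v, `|v| <= 1 ->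
  \sum_(n < N) 2 ^+ n * t0 * sqdist X v (pi n v) <= 2 * (1 + N%:R * eta).

Local Notation C0 := (sep_const R).

Lemma ln_nat_ge_half : 2^-1 <= l.
Proof.
have h : 2 <= m%:R :> R by rewrite ler_nat.
apply: (@le_trans _ _ (ln 2)); last by rewrite ler_ln ?posrE//; lra.
rewrite -ler_expR lnK ?posrE//.
have := expR_ge1Dx (- 2^-1 : R); have := expR_gt0 (2^-1 : R); rewrite expRN => h1 h2.
have h3 : 2^-1 <= (expR 2^-1)^-1 :> R by lra.
by move: h3; rewrite lef_pV2 ?posrE.
Qed.

Let l0 : 0 < l. Proof. by rewrite (lt_le_trans _ ln_nat_ge_half). Qed.
Let lam0 : 0 < lambda. Proof. by rewrite (lt_le_trans _ lambda1). Qed.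
Let kap0 : 0 < kap. Proof. by rewrite !mulr_gt0. Qed.
Let r0 n : 0 < r n. Proof. by rewrite divr_gt0 ?mulr_gt0 ?exprn_gt0. Qed.
Let D0 x x' : 0 <= D x x'. Proof. exact: sqdist_ge0. Qed.
Let s0 n x : 0 <= s n x. Proof. exact: sqdist_ge0. Qed.
Let t00 : 0 < t0. Proof. by rewrite invr_gt0 mulr_gt0 ?exprn_gt0. Qed.
Let C00 : 1 <= C0. Proof. exact: sep_const_ge1. Qed.

(** Both [4] and [2 m] are at most [exp (2 l)], and [k <= 2 c], so the exponent is at most
    [(2 + 5 c) l]. *)
Lemma card_cells (c : R) (k n : nat) :
  4 ^+ n <= c -> k%:R <= c + 4 ^+ n ->
  4 * (expR (c * l) * (2 * m%:R) ^+ k) <= expR (10 * c * l).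
Proof.
move=> c1 kc.
have c0 : 1 <= c by rewrite (le_trans _ c1)// exprn_ege1// ler1n.
have m0 : 0 < m%:R :> R by rewrite ltr0n (leq_trans _ m2).
have h : 2 <= m%:R :> R by rewrite ler_nat.
have e : m%:R = expR l by rewrite lnK ?posrE.
have h2 : 2 * m%:R <= expR (2 * l).
  by rewrite (_ : 2 * l = l + l); [rewrite expRD -e ler_pM2r|ring].
have h4 : 4 <= expR (2 * l).
  by apply: le_trans h2; lra.
apply: (@le_trans _ _ (expR (2 * l) * (expR (c * l) * expR (2 * l) ^+ k))).
  rewrite ler_pM ?mulr_ge0 ?expR_ge0 ?exprn_ge0 ?mulr_ge0 ?(ltW m0)//.
  rewrite ler_wpM2l ?expR_ge0// lerXn2r ?nnegrE ?expR_ge0// mulr_ge0//.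
rewrite -expRM_natl -!expRD ler_expR.
have := l0; move: h; have := ltW l0 => *.
have : k%:R * l <= (2 * c) * l by rewrite ler_wpM2r//; lra.
have : l <= c * l by rewrite ler_peMl.
lra.
Qed.

(** The points are replaced by their images under [pi n], which [pi_close] confines to a small norm
    diameter. A separated net of images is counted by [card_sqdist_separated], and returning to the
    points costs [2 * sb]. The count depends neither on [sb] nor on [Delta]. *)
Lemma cell_cover (n : nat) (S : {set T}) (sb Delta : R) :
  (forall x, x \in S -> s n x <= sb) ->
  (forall x x', x \in S -> x' \in S -> D x x' <= Delta) ->
  exists f : T -> T,
    (forall x, x \in S -> f x \in S /\
       D x (f x) <= (Delta + sb + r n) / 8 + 2 * sb) /\
    #|f @: S|%:R <= expR (10 * (C0 * 145) * (4 ^+ n * l)).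
Proof.
move=> Ss SD; have [->|[a aS]] := finset.set_0Vmem S.
  by exists id; split => [x|]; rewrite ?finset.in_set0// finset.imset0 cards0 expR_ge0.
(* The summand [r n] keeps [d] at least at the scale of the level, which gives [eta <= t * d] and
   later controls [1 / d]. *)
pose d := Delta + sb + r n.
have Delta0 : 0 <= Delta := le_trans (D0 _ _) (SD a a aS aS).
have sb0 : 0 <= sb := le_trans (s0 _ _) (Ss a aS).
have d0 : 0 < d by rewrite ltr_wpDl// addr_ge0.
have rd : r n <= d by rewrite lerDr addr_ge0.
pose close x x' := sqdist X (pi n (y x)) (pi n (y x')) <= d / 8.
have [f [fS fsep]] := @separated_net T close S
  (fun x => eq_ind_r (fun z => z <= d / 8) (ltW (divr_gt0 d0 (ltr0n R 8))) (sqdistxx _ _))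
  (fun x x' => congr1 (fun z => z <= d / 8) (sqdistC _ _ _)).
exists f; split.
  move=> x xS; have [fxS cx] := fS x xS; split => //.
  rewrite -/d /D; apply: le_trans (sqdist_triangle _ _ (pi n (y x)) _) _.
  apply: le_trans (lerD (lexx _) (sqdist_triangle _ _ (pi n (y (f x))) _)) _.
  rewrite (sqdistC _ _ (y (f x))); have := Ss x xS; have := Ss _ fxS.
  by rewrite /s; move: cx; rewrite /close; lra.
pose t := 2 ^+ n * t0.
have tp : 0 < t by rewrite mulr_gt0 ?exprn_gt0.
have tr : t * r n * l = 1.
  by rewrite /t /r /t0; field; rewrite !gt_eqF.
have etat : eta <= t * d.
  apply: (@le_trans _ _ (t * r n)); last by rewrite ler_pM2l.
  by rewrite -(ler_pM2r l0) tr.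
(* In [pi_close] the bracket is at most [t d + 2 t d], whence the factor [12 = 4 * 3]. *)
pose rad := Num.sqrt (12 * lambda ^+ 2 * t * d).
have rad2 : rad ^+ 2 = 12 * lambda ^+ 2 * t * d.
  by rewrite sqr_sqrtr// !mulr_ge0 ?sqr_ge0// ltW.
have radp : 0 < rad by rewrite sqrtr_gt0 !mulr_gt0 ?exprn_gt0.
have close_rad x x' : x \in S -> x' \in S -> `|pi n (y x) - pi n (y x')| <= rad.
  move=> xS x'S; rewrite -[leLHS]ger0_norm// -sqrtr_sqr ler_wsqrtr//.
  apply: le_trans (pi_close _ _ _) _; rewrite -/t.
  rewrite (_ : 12 * _ * _ * _ = 4 * lambda ^+ 2 * (3 * (t * d))); last by ring.
  apply: ler_wpM2l; first by apply: mulr_ge0 => //; exact: sqr_ge0.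
  have h : t * (s n x + s n x' + D x x') <= t * (2 * d).
    rewrite ler_wpM2l ?(ltW tp)//; have := Ss x xS; have := Ss x' x'S.
    by have := SD x x' xS x'S; rewrite /d; have := r0 n; lra.
  by rewrite /s /D in h; lra.
pose c := C0 * 144 * 4 ^+ n.
have C0p : 0 <= C0 by apply: le_trans C00.
have c0 : 0 <= c by apply: mulr_ge0; [rewrite mulr_ge0|rewrite exprn_ge0].
pose k := Num.truncn c.
have /andP[kc ck] := truncn_itv c0.
pose I : finType := {x | x \in f @: S}.
have IS (i : I) : val i \in S.
  by have /imsetP[x xS ->] := valP i; case: (fS x xS).
have -> : #|f @: S| = #|I| by rewrite card_sig; apply: eq_card => x; rewrite inE.
have four : 1 <= 4 ^+ n :> R by rewrite exprn_ege1// ler1n.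
have four0 : 0 < 4 ^+ n :> R by rewrite (lt_le_trans _ four).
have pow4 : 4 ^+ n = (2 ^+ n) ^+ 2 :> R.
  by rewrite -exprM mulnC exprM; congr (_ ^+ _); ring.
have := @card_sqdist_separated _ _ _ X tau M A tau0 M0 A0 Etau XM XA I k.+1
  (fun i => pi n (y (val i))) (pi n (y a)) rad d.
move=> /(_ (leq_trans _ m2) _ radp d0 (pi1 _ _)).
move=> /(_ isT isT) /(_ (fun i => close_rad _ _ (IS i) aS)).
move=> /(_ (fun i i' => close_rad _ _ (IS i) (IS i'))).
have Dbound (i : I) : sqdist X (pi n (y (val i))) (pi n (y a)) <= 2 * d.
  apply: le_trans (sqdist_triangle _ _ (y (val i)) _) _.
  apply: le_trans (lerD (lexx _) (sqdist_triangle _ _ (y a) _)) _.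
  rewrite (sqdistC _ (pi n (y (val i)))).
  have := SD _ _ (IS i) aS; have := Ss _ (IS i); have := Ss _ aS.
  by rewrite /s /D /d; have := r0 n; lra.
have sep (i i' : I) : i != i' -> d / 8 < sqdist X (pi n (y (val i))) (pi n (y (val i'))).
  by move=> ii'; have := fsep _ _ (valP i) (valP i') ii'; rewrite -ltNge.
move=> /(_ Dbound sep); rewrite -/kap.
(* As [rad ^+ 4] is proportional to [d ^+ 2], the number of samples required depends only on the
   level. *)
have h1 : C0 * kap ^+ 2 * rad ^+ 4 / d ^+ 2 = c.
  rewrite (_ : rad ^+ 4 = (rad ^+ 2) ^+ 2); last by rewrite -exprM.
  rewrite rad2 /c pow4 /t /t0; field; rewrite !gt_eqF//.
rewrite h1 => /(_ (ltW ck)) /le_trans; apply.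
have h2 : C0 * kap ^+ 2 * rad ^+ 2 / d ^+ 2 <= c * l.
  rewrite rad2 (_ : _ / _ = C0 * 12 * kap ^+ 2 * lambda ^+ 2 * t / d); last first.
    by field; rewrite gt_eqF.
  rewrite ler_pdivrMr//; apply: (@le_trans _ _ (c * l * r n)); last first.
    by rewrite ler_wpM2l// mulr_ge0// ltW.
  have -> : c * l * r n = C0 * 144 * kap * 2 ^+ n * lambda ^+ 2.
    by rewrite /c pow4 /r; field; rewrite !gt_eqF ?exprn_gt0.
  have -> : C0 * 12 * kap ^+ 2 * lambda ^+ 2 * t = C0 * 12 * kap * 2 ^+ n.
    by rewrite /t /t0; field; rewrite !gt_eqF.
  have q0 : 0 <= C0 * 12 * kap * 2 ^+ n.
    apply: mulr_ge0; last exact: exprn_ge0.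
    by apply: mulr_ge0; [exact: mulr_ge0|exact: ltW].
  have l1 : 1 <= lambda ^+ 2 by rewrite exprn_ege1.
  by rewrite (_ : C0 * 144 * _ * _ * _ = C0 * 12 * kap * 2 ^+ n * (12 * lambda ^+ 2)); [rewrite ler_peMr//; lra|ring].
apply: (@le_trans _ _ (4 * (expR (C0 * 145 * 4 ^+ n * l) * (2 * m%:R) ^+ k.+1))).
  rewrite ler_wpM2l// ler_wpM2r ?exprn_ge0 ?mulr_ge0// ler_expR (le_trans h2)//.
  rewrite ler_wpM2r ?(ltW l0)// /c ler_wpM2r ?(ltW four0)//; lra.
rewrite (_ : 10 * _ * _ = 10 * (C0 * 145 * 4 ^+ n) * l); last by ring.
apply: (@card_cells _ _ n); first by rewrite ler_peMl ?(ltW four0)//; have := C00; lra.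
rewrite -natr1; have : c <= C0 * 145 * 4 ^+ n by rewrite /c ler_wpM2r ?(ltW four0)//; lra.
by lra.
Qed.

Let K : R := 10 * (C0 * 145) + 4.

(** Rounding [s n x] to multiples of [r n] leaves finitely many classes per level, on each of which
    the upper rounding [sbar] is constant. *)
Let level n x := Num.truncn (s n x / r n).

Let sbar n x : R := (level n x).+1%:R * r n.

(** A bound for the distance from [x] to the center of its cell. The recursion is [cell_cover] with
    diameter twice the radius; its factor 1/4 outweighs the doubling of the chaining weights. *)
Fixpoint radius n x : R :=
  if n is k.+1 then radius k x / 4 + 3 * sbar k x + r k else M * A.

Let s_le_sbar n x : s n x <= sbar n x.
Proof.
rewrite -ler_pdivrMr// ltW//.
by have /truncn_itv/andP[] : 0 <= s n x / r n by rewrite divr_ge0// ltW.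
Qed.

Let sbar_le n x : sbar n x <= s n x + r n.
Proof.
rewrite /sbar -natr1 mulrDl mul1r lerD2r -ler_pdivlMr//.
by have /truncn_itv/andP[] : 0 <= s n x / r n by rewrite divr_ge0// ltW.
Qed.

Let sum_s x : \sum_(n < N) 2 ^+ n * t0 * s n x <= 4.
Proof. by apply: le_trans (pi_sum _ (y1 x)) _; have := etaN; lra. Qed.

Let level_le n x : (n < N)%N -> (level n x)%:R <= 4 * l.
Proof.
move=> nN; apply: (@le_trans _ _ (s n x / r n)).
  by have /truncn_itv/andP[] : 0 <= s n x / r n by rewrite divr_ge0// ltW.
have : 2 ^+ n * t0 * s n x <= 4.
  apply: le_trans (sum_s x); rewrite (bigD1 (Ordinal nN))//= lerDl.
  apply: sumr_ge0 => i _; apply: mulr_ge0 => //; apply: mulr_ge0; last exact: ltW.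
  by rewrite exprn_ge0.
have -> : s n x / r n = 2 ^+ n * t0 * s n x * l.
  by rewrite /r /t0; field; rewrite !gt_eqF ?exprn_gt0.
by rewrite ler_pM2r.
Qed.

Let radius_ge0 n x : 0 <= radius n x.
Proof.
elim: n => [|n IH] /=; first by rewrite mulr_ge0 ?ltW.
have h1 := r0 n; have h2 := s0 n x; have h3 := s_le_sbar n x; lra.
Qed.

(** The cells are the fibers of [c], and [c x] is the center of the cell of [x]. Constancy of the
    radius on fibers gives each cell a single diameter bound. *)
Definition chain_inv n (c : T -> T) :=
  [/\ forall x, D x (c x) <= radius n x,
      forall x x', c x = c x' -> radius n x = radius n x' &
      #|[set c x | x : T]%SET|%:R <= expR (K * (4 ^+ n * l))].

(** Each fiber of [c] is split according to [level], and every piece is covered by [cell_cover]. New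
    centers stay in their piece, which makes the partitions nested. *)
Lemma refine_partition n c : (n < N)%N -> chain_inv n c ->
  exists c', chain_inv n.+1 c' /\ forall x, c (c' x) = c x.
Proof.
move=> nN [cD crad ccard].
pose cell (aj : T * nat) := [set x | (c x == aj.1) && (level n x == aj.2)]%SET.
(* The radius common to the piece, with default 0 on an empty piece. *)
pose rad (aj : T * nat) := if [pick x in cell aj] is Some x then radius n x else 0.
have radE x : rad (c x, level n x) = radius n x.
  rewrite /rad; case: pickP => [x'|/(_ x)]; last by rewrite inE !eqxx.
  by rewrite inE => /andP[/eqP/= cx _]; exact: crad.
have /choice[F FP] : forall aj : T * nat, exists f : T -> T,
    (forall x, x \in cell aj -> f x \in cell aj /\
       D x (f x) <= (2 * rad aj + aj.2.+1%:R * r n + r n) / 8 + 2 * (aj.2.+1%:R * r n)) /\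
    #|f @: cell aj|%:R <= expR (10 * (C0 * 145) * (4 ^+ n * l)).
  move=> aj; apply: cell_cover.
    by move=> x; rewrite inE => /andP[_ /eqP <-]; exact: s_le_sbar.
  move=> x x'; rewrite !inE => /andP[/eqP cx /eqP lx] /andP[/eqP cx' /eqP lx'].
  have e1 : rad aj = radius n x by rewrite -radE cx lx -surjective_pairing.
  have e2 : rad aj = radius n x' by rewrite -radE cx' lx' -surjective_pairing.
  apply: le_trans (sqdist_triangle _ _ (y (c x)) _) _.
  rewrite {2}cx -cx' (sqdistC _ (y (c x'))).
  by have := cD x; have := cD x'; rewrite /D -e1 -e2; lra.
pose c' x := F (c x, level n x) x.
have c'P x : [/\ c (c' x) = c x, level n (c' x) = level n x &
    D x (c' x) <= (2 * radius n x + sbar n x + r n) / 8 + 2 * sbar n x].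
  have [/(_ x)] := FP (c x, level n x); rewrite !inE !eqxx/= => /(_ isT)[].
  by move=> /andP[/eqP h1 /eqP h2] h3 _; split => //; rewrite -[radius n x]radE.
exists c'; split; last by move=> x; case: (c'P x).
split.
- move=> x; have [_ _ h] := c'P x; apply: le_trans h _ => /=.
  by have := r0 n; have := s_le_sbar n x; have := s0 n x; lra.
- move=> x x' e; have [h1 h2 _] := c'P x; have [h1' h2' _] := c'P x'.
  by rewrite /= /sbar -h2 -h2' e (crad x x')// -h1 -h1' e.
(* By [level_le] the levels are at most [4 l]; counting level 0 there are
   [J <= 1 + 4 l <= exp (4 l)] of them. *)
pose J := (Num.truncn (4 * l)).+1.
have Jl x : (level n x < J)%N.
  by rewrite ltnS truncn_ge_nat ?level_le// mulr_ge0// ltW.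
pose idx := finset.setX [set c x | x : T]%SET [set: 'I_J]%SET.
have sub : [set c' x | x : T]%SET \subset
    \bigcup_(aj in idx) (F (aj.1, nat_of_ord aj.2) @: cell (aj.1, nat_of_ord aj.2)).
  apply/fintype.subsetP => _ /imsetP[x _ ->]; apply/finset.bigcupP.
  exists (c x, Ordinal (Jl x)).
    by rewrite !inE/= andbT; apply/imsetP; exists x.
  by apply/imsetP; exists x => //; rewrite inE/= !eqxx.
have := subset_leq_card sub; rewrite -(ler_nat R) => /le_trans; apply.
apply: (@le_trans _ _ (\sum_(aj in idx) expR (10 * (C0 * 145) * (4 ^+ n * l)))).
  apply: (@le_trans _ _ (\sum_(aj in idx)
      #|F (aj.1, nat_of_ord aj.2) @: cell (aj.1, nat_of_ord aj.2)|%:R)).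
    rewrite -natr_sum ler_nat; elim/big_rec2: _ => [|aj p q _ h].
      by rewrite cards0.
    by rewrite (leq_trans (leq_card_setU _ _))// leq_add2l.
  by apply: ler_sum => aj _; case: (FP (aj.1, nat_of_ord aj.2)).
rewrite sumr_const -[leLHS]mulr_natl finset.cardsX finset.cardsT card_ord natrM.
have hJ : J%:R <= expR (4 * l).
  rewrite /J -natr1 addrC; apply: le_trans (expR_ge1Dx _); rewrite lerD2l.
  by have /truncn_itv/andP[] : 0 <= 4 * l by rewrite mulr_ge0// ltW.
apply: (@le_trans _ _ (expR (K * (4 ^+ n * l)) * expR (4 * l) *
    expR (10 * (C0 * 145) * (4 ^+ n * l)))).
  by rewrite ler_wpM2r ?expR_ge0// ler_pM.
(* The exponents add up to at most [2 K] times [4 ^+ n * l], while the next level allows [4 K]. *)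
rewrite -!expRD ler_expR exprS.
have : l <= 4 ^+ n * l by rewrite ler_peMl ?(ltW l0)// exprn_ege1// ler1n.
have : 0 <= K * (4 ^+ n * l).
  by rewrite /K !mulr_ge0 ?exprn_ge0// ?(ltW l0)//; have := C00; lra.
have : 0 <= C0 * (4 ^+ n * l).
  by rewrite !mulr_ge0 ?exprn_ge0// ?(ltW l0)//; have := C00; lra.
rewrite /K; set q := 4 ^+ n * l; rewrite -[4 * 4 ^+ n * l]mulrA -/q; lra.
Qed.

Let D_base x : D x x0 <= M * A.
Proof.
apply: (@le_trans _ _ (M * l2norm (evals X (y x)))); last first.
  by rewrite ler_wpM2l ?(ltW M0)// XA.
rewrite -l2normZ ?(ltW M0)// /D y0; apply: l2norm_mono => j.
rewrite evals0 /ssqr mul0r subr0 !normrM normr_id (gtr0_norm M0) ler_wpM2r//.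
by apply: le_trans (dual_norm_ge _ _) _; rewrite -[leRHS]mulr1 ler_pM.
Qed.

Lemma partition_chain : exists c : nat -> T -> T,
  [/\ forall x, c 0%N x = x0,
      forall n, (n <= N)%N -> chain_inv n (c n) &
      forall n x, (n < N)%N -> c n (c n.+1 x) = c n x].
Proof.
suff build : forall k, (k <= N)%N -> exists c : nat -> T -> T,
  [/\ forall x, c 0%N x = x0,
      forall n, (n <= k)%N -> chain_inv n (c n) &
      forall n x, (n < k)%N -> c n (c n.+1 x) = c n x] by exact: build (leqnn N).
elim=> [_|k IH kN].
  exists (fun _ _ => x0); split => // n; rewrite leqn0 => /eqP ->; split => //=.
  rewrite (_ : [set x0 | _ : T]%SET = [set x0]%SET).
    rewrite cards1 -[leLHS]expR0 ler_expR expr0 mul1r mulr_ge0// ?(ltW l0)//.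
    by rewrite /K; have := C00; lra.
  apply/finset.setP => z; rewrite inE; apply/imsetP/eqP => [[_ _ ->]//|->].
  by exists x0.
have [c [c0 cinv cc]] := IH (ltnW kN).
have [c' [c'inv c'c]] := refine_partition kN (cinv k (leqnn k)).
exists (fun n => if (n <= k)%N then c n else c'); split => //.
- move=> n; rewrite leq_eqVlt => /predU1P[->|]; first by rewrite ltnn.
  by rewrite ltnS => nk; rewrite nk; exact: cinv.
- move=> n x; rewrite ltnS => nk; rewrite nk; have [nk'|kn] := ltnP n k; first exact: cc.
  by have -> : n = k; [apply/eqP; rewrite eqn_leq nk|exact: c'c].
Qed.

Hypotheses (tau1 : 1 <= tau) (Nl : N%:R <= 4 * l).
Hypothesis TN : #|T|%:R <= expR (4 ^+ N.+1 * l).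

(** Weights double while radii are quartered, so the sum is an exact combination of the initial
    radius and the terms added at each level ([key]). The constant is [114 = 2 + 4 * 28]. *)
Lemma sum_radius x :
  \sum_(n < N.+1) 2 ^+ n * Num.sqrt l * radius n x
  <= 114 * (kap * lambda ^+ 2 * Num.sqrt l).
Proof.
pose g n : R := 2 ^+ n * Num.sqrt l; pose q := kap * lambda ^+ 2 * Num.sqrt l.
have sl : 0 < Num.sqrt l by rewrite sqrtr_gt0.
have key k : \sum_(n < k.+1) g n * radius n x + g k * radius k x =
    2 * (g 0%N * (M * A)) + 4 * \sum_(n < k) g n * (3 * sbar n x + r n).
  elim: k => [|k IH]; first by rewrite big_ord1 big_ord0 /=; ring.
  have gS : g k.+1 = 2 * g k by rewrite /g exprS mulrA.
  rewrite [in LHS]big_ord_recr [in RHS]big_ord_recr gS /=.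
  by move: IH; lra.
have gN : 0 <= g N * radius N x.
  by apply: mulr_ge0 => //; apply: mulr_ge0; [rewrite exprn_ge0|exact: ltW].
have keyN := key N.
have q0 : 0 <= q by apply: mulr_ge0; [rewrite mulr_ge0 ?exprn_ge0 ?(ltW kap0) ?(ltW lam0)|exact: ltW].
have h1 : g 0%N * (M * A) <= q.
  have lam1 : 1 <= lambda ^+ 2 by rewrite exprn_ege1.
  have MA : 0 <= M * A by rewrite mulr_ge0 ?ltW.
  rewrite /g expr0 mul1r /q [leRHS]mulrC ler_wpM2l ?(ltW sl)//.
  rewrite (_ : kap * _ = (tau * lambda ^+ 2) * (M * A)); last by rewrite /kap; ring.
  by rewrite ler_peMl//; have := tau1; nra.
(* Of the 28, the interpolation sum, at most 4, accounts for [3 * 4], and the rounding errors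
   [4 * r n] over [N <= 4 l] levels for 16. *)
have h2 : \sum_(n < N) g n * (3 * sbar n x + r n) <= 28 * q.
  apply: (@le_trans _ _ (\sum_(n < N) (3 * q * (2 ^+ n * t0 * s n x) + 4 * (q / l)))).
    apply: ler_sum => n _.
    have e1 : q * (2 ^+ n * t0 * s n x) = g n * s n x.
      by rewrite /q /t0 /g; field; rewrite !gt_eqF.
    have e2 : q / l = g n * r n.
      by rewrite /q /g /r; field; rewrite !gt_eqF ?exprn_gt0.
    rewrite (_ : 3 * q * _ = 3 * (q * (2 ^+ n * t0 * s n x))); last by ring.
    rewrite e1 e2.
    have gn0 : 0 <= g n by apply: mulr_ge0; [rewrite exprn_ge0|exact: ltW].
    have := ler_wpM2l gn0 (sbar_le n x); lra.
  rewrite big_split/= -mulr_sumr sumr_const card_ord -[X in _ + X]mulr_natl.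
  have h3 : 3 * q * \sum_(n < N) 2 ^+ n * t0 * s n x <= 3 * q * 4.
    by apply: ler_wpM2l; [exact: mulr_ge0|exact: sum_s].
  have h4 : N%:R * (4 * (q / l)) <= 16 * q.
    rewrite (_ : N%:R * _ = N%:R * (4 * q) / l); last by field; rewrite gt_eqF.
    rewrite ler_pdivrMr//.
    have := ler_wpM2r (mulr_ge0 (ler0n R 4) q0) Nl; lra.
  lra.
by rewrite -/(g _) -/q; lra.
Qed.

(** After the [N] refinements one last level is added at which every point is its own center; [TN]
    bounds its size. A link is at most the sum of two consecutive radii, which doubles 114 to
    228. *)
Lemma finite_chaining_bound (sel : {ffun 'I_m -> bool} -> T) :
  \sum_s `|rademacher_sum (fun j => evals X (y (sel s)) j ^+ 2) s|
  <= 2 ^+ m * ((Num.sqrt (32 * K + 64) + 4) * (228 * (kap * lambda ^+ 2 * Num.sqrt l))).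
Proof.
have [c [c0 cinv cc]] := partition_chain.
pose c' n := if (n <= N)%N then c n else id.
have K1 : 1 <= K by rewrite /K; have := C00; lra.
rewrite -[X in _ ^+ X]card_ord.
apply: (@chaining _ _ _ (fun x j => evals X (y x) j ^+ 2) D x0 N.+1 c' l K) => //.
- exact: ln_nat_ge_half.
- by rewrite (le_trans _ K1).
- by move=> j; rewrite y0 evals0 expr0n.
- by move=> x; rewrite /c' ltnn.
- move=> n x; rewrite ltnS leq_eqVlt => /predU1P[->|nN].
    by rewrite /c' leqnn ltnn.
  by rewrite /c' nN (ltnW nN); exact: cc.
- move=> n; rewrite leq_eqVlt => /predU1P[->|].
    rewrite /c' ltnn; apply: (@le_trans _ _ #|T|%:R).
      by rewrite ler_nat max_card.
    apply: le_trans TN _; rewrite ler_expR ler_peMl//.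
    by rewrite mulr_ge0 ?exprn_ge0// ltW.
  by rewrite ltnS /c' => nN; rewrite nN; case: (cinv n nN).
- by move=> x x'; apply: l2norm_mono => j; exact: sqr_sub_le_ssqr.
move=> x; have cD n : (n <= N)%N -> D x (c n x) <= radius n x.
  by move=> nN; case: (cinv n nN).
pose g n : R := 2 ^+ n * Num.sqrt l.
have g0 n : 0 <= g n by apply: mulr_ge0; [rewrite exprn_ge0|exact: sqrtr_ge0].
have gS n : g n.+1 = 2 * g n by rewrite /g exprS mulrA.
apply: (@le_trans _ _ (2 * \sum_(n < N.+1) g n * radius n x)); last first.
  by have := sum_radius x; rewrite -/g; lra.
rewrite big_ord_recr/= [X in _ <= 2 * X]big_ord_recr/= /c' leqnn ltnn.
have last_le : g N * D x (c N x) <= g N * radius N x by rewrite ler_wpM2l// cD.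
have step_le : \sum_(n < N) g n * D (c' n.+1 x) (c' n x) <=
    \sum_(n < N) (g n * radius n x + 2^-1 * (g n.+1 * radius n.+1 x)).
  apply: ler_sum => n _; have nN := ltn_ord n.
  rewrite /c' nN (ltnW nN) gS.
  have h : D (c n.+1 x) (c n x) <= radius n x + radius n.+1 x.
    apply: le_trans (sqdist_triangle _ _ (y x) _) _; rewrite sqdistC addrC.
    by apply: lerD; apply: cD => //; exact: ltnW.
  by have := ler_wpM2l (g0 n) h; lra.
have gr0 n : 0 <= g n * radius n x by apply: mulr_ge0; [exact: g0|exact: radius_ge0].
have shift : \sum_(n < N) g n.+1 * radius n.+1 x <= \sum_(n < N) g n * radius n x + g N * radius N x.
  rewrite -(big_ord_recr _ (fun n => g n * radius n x)) big_ord_recl lerDr.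
  exact: (gr0 0%N).
have r0' := gr0 N.
have s0' : 0 <= \sum_(n < N) g n * radius n x by exact: sumr_ge0.
move: step_le; rewrite big_split/= -mulr_sumr /c' => step_le.
by rewrite -/(g N); lra.
Qed.

End partition.

(** * The bound for a finite selection of points *)

Definition chain_const (R : realType) : R :=
  (Num.sqrt (32 * (10 * (sep_const R * 145) + 4) + 64) + 4) * 228.

Lemma chain_const_gt0 (R : realType) : 0 < chain_const R.
Proof. by rewrite mulr_gt0// ltr_wpDl// sqrtr_ge0. Qed.

Lemma finite_bound (R : realType) (E : normedModType R) (m : nat)
    (X : 'I_m -> dual E) (tau M A lambda : R) (y : {ffun 'I_m -> bool} -> E) :
  (2 <= m)%N -> 1 <= tau -> 0 < M -> 0 < A -> 1 <= lambda ->
  convex_power_type2 E lambda ->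
  rademacher_type2 (dual E) tau ->
  (forall j, `|X j| <= M) ->
  (forall v, `|v| <= 1 -> l2norm (evals X v) <= A) ->
  (forall s, `|y s| <= 1) ->
  \sum_s `|rademacher_sum (fun j => evals X (y s) j ^+ 2) s|
  <= 2 ^+ m * (chain_const R * (tau * M * A * lambda ^+ 2 * Num.sqrt (ln m%:R))).
Proof.
move=> m2 tau1 M0 A0 lambda1 cvx Etau XM XA y1.
(* With [m <= 2 ^ N] the last level may hold all [2^m + 1] points, since [m + 1 <= 4 ^ N.+1], while
   [N] remains of order [log m]. *)
pose N := up_log 2 m; pose l : R := ln m%:R.
have lh : 2^-1 <= l := ln_nat_ge_half m2.
have tau0 : 0 < tau by apply: lt_le_trans tau1.
have lam0 : 0 < lambda by apply: lt_le_trans lambda1.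
have l0 : 0 < l by apply: lt_le_trans lh.
have m0 : 0 < m%:R :> R by rewrite ltr0n (leq_trans _ m2).
have N1 : (0 < N)%N by rewrite up_log_gt0.
have Nl : N%:R <= 4 * l.
  have h : (2 ^ N.-1 < m)%N by have /andP[] := up_log_bounds (isT : (1 < 2)%N) m2.
  have : N.-1%:R * ln (2 : R) <= l.
    rewrite mulr_natl -lnXn// ler_ln ?posrE ?exprn_gt0//.
    by rewrite -natrX ler_nat ltnW.
  have := @ln_nat_ge_half R 2 (leqnn 2) => l2.
  have : N.-1%:R * 2^-1 <= N.-1%:R * ln (2 : R) by rewrite ler_wpM2l.
  have : N%:R = N.-1%:R + 1 :> R by rewrite natr1 prednK.
  by move=> -> *; lra.
(* Small enough that both [eta * l] and [N * eta] are at most 1. *)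
pose eta := (1 + N%:R + l)^-1.
have e0 : 0 < 1 + N%:R + l by rewrite addr_gt0// ltr_pwDl.
have eta0 : 0 < eta by rewrite invr_gt0.
have etal : eta * l <= 1.
  by rewrite mulrC ler_pdivrMr// mul1r lerDr addr_ge0.
have etaN : N%:R * eta <= 1.
  by rewrite ler_pdivrMr// mul1r; lra.
have t0 : 0 < (tau * M * A * lambda ^+ 2)^-1 by rewrite invr_gt0 !mulr_gt0.
have [p [p1 pc ps]] := interpolation X lam0 cvx t0 eta0.
(* [None] is the root of the chain, at which the process vanishes. *)
pose T := option {ffun 'I_m -> bool}.
pose yT (x : T) := if x is Some s then y s else 0.
have yT1 x : `|yT x| <= 1 by case: x => [s|] /=; [exact: y1|rewrite normr0].
have TN : #|{: T}|%:R <= expR (4 ^+ N.+1 * l).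
  rewrite card_option card_ffun card_bool card_ord.
  apply: (@le_trans _ _ ((m ^ m.+1)%:R)).
    rewrite ler_nat (leq_trans (_ : _ <= 2 ^ m.+1)%N)//.
      by rewrite expnS mul2n -addnn -addn1 leq_add2l expn_gt0.
    by rewrite leq_exp2r.
  rewrite natrX -[X in X ^+ _](@lnK R) ?posrE// -expRM_natl ler_expR ler_wpM2r ?(ltW l0)//.
  rewrite -natrX ler_nat expnS.
  have h : (m <= 2 ^ N)%N by have /andP[] := up_log_bounds (isT : (1 < 2)%N) m2.
  have h2 : (2 ^ N <= 4 ^ N)%N by rewrite leq_exp2r.
  have := leq_trans h h2; have : (0 < 4 ^ N)%N by rewrite expn_gt0.
  move: (4 ^ N)%N => q q0 mq; rewrite mulSn -addn1 addnC leq_add//.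
  by rewrite (leq_trans mq)// leq_pmull.
have := @finite_chaining_bound R E m T X tau M A lambda eta N yT None p
  m2 tau0 M0 A0 lambda1 Etau XM XA yT1 erefl etal etaN p1 pc ps tau1 Nl TN Some.
by rewrite [X in _ * X]mulrA => h; exact: h.
Qed.

(** * From Gaussian to Rademacher type 2 *)

Local Open Scope classical_set_scope.

Section gaussians_exist.
Context {R : realType}.
Local Open Scope ereal_scope.

Definition mfun_of d (T : measurableType d) (f : T -> R)
    (mf : measurable_fun setT f) : {mfun T >-> R} :=
  HB.pack f (isMeasurableFun.Build _ _ _ _ f mf).

Definition gauss : probability (measurableTypeR R) R := normal_prob (0 : R) 1.

(** The type 2 hypothesis quantifies over Gaussian families, so using it requires one. The induction
    adds a coordinate by a product with [gauss]. *)
Lemma gaussians_exist (n : nat) :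
  exists (d : measure_display) (T : measurableType d) (P : probability T R)
    (g : 'I_n -> {RV P >-> R}),
  independent_RV g /\ forall i, standard_gaussian (g i).
Proof.
elim: n => [|n [d [T [P [g [ig gg]]]]]].
  exists _, _, gauss, (fun=> mfun_of (@measurable_id _ (measurableTypeR R) setT)).
  split=> [A mA|[]//]; rewrite big_ord0 (_ : \bigcap_(_ in _) _ = setT) ?probability_setT//.
  by rewrite -subTset => x _ [].
pose g' (i : 'I_n.+1) : measurableTypeR R * T -> R :=
  if unlift ord0 i is Some j then g j \o snd else fst.
have mg' i : measurable_fun setT (g' i).
  rewrite /g'; case: unlift => [j|]; last exact: measurable_fst.
  exact: measurableT_comp.
exists _, _, (gauss \x P), (fun i => mfun_of (mg' i)).
have g'0 A : g' ord0 @^-1` A = A `*` setT.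
  by rewrite /g' unlift_none; apply/seteqP; split => [x|x []]//=.
have g'S j A : g' (lift ord0 j) @^-1` A = setT `*` (g j @^-1` A).
  by rewrite /g' liftK; apply/seteqP; split => [x|x []]//=.
have m0 A : measurable A -> (gauss \x P) (g' ord0 @^-1` A) =
    gauss A.
  by move=> mA; rewrite g'0 product_measure1E// -[RHS]mule1 -(probability_setT P).
have mS j A : measurable A -> (gauss \x P) (g' (lift ord0 j) @^-1` A) =
    P (g j @^-1` A).
  move=> mA; rewrite g'S product_measure1E//; last by rewrite -[X in measurable X]setTI; exact: measurable_funP.
  by rewrite -[RHS]mul1e -(probability_setT gauss).
split=> [A mA|i A mA].
  rewrite big_ord_recl /= m0//; under eq_bigr => i _ do rewrite mS//.
  rewrite -ig => [|i]; last exact: mA.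
  rewrite -product_measure1E; [|exact: mA|]; last first.
    apply: fin_bigcap_measurable => [|i _]; first exact: finite_finset.
    by rewrite -[X in measurable X]setTI; exact: measurable_funP.
  congr (_ _); apply/seteqP; split => [[x y] h|[x y] [/= hx hy] i _].
    split=> [|j _].
      by have : (g' ord0 @^-1` A ord0) (x, y) := h ord0 I; rewrite g'0 => -[].
    have : (g' (lift ord0 j) @^-1` A (lift ord0 j)) (x, y) := h (lift ord0 j) I.
    by rewrite g'S => -[].
  have [j ->|->] := unliftP ord0 i.
    suff : (g' (lift ord0 j) @^-1` A (lift ord0 j)) (x, y) by [].
    by rewrite g'S; split => //; exact: hy.
  by suff : (g' ord0 @^-1` A ord0) (x, y) by []; rewrite g'0.
have [j ->|->] := unliftP ord0 i; rewrite /distribution /pushforward /=.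
  by rewrite mS//; exact: gg.
by rewrite m0.
Qed.

End gaussians_exist.

(** * Signs and absolute values of Gaussians *)

Section gauss_sign.
Context {R : realType}.
Local Open Scope ereal_scope.
Local Notation mu := (@lebesgue_measure R).
Local Notation gauss := (@gauss R).

Definition sign_set (b : bool) : set R := [set x | (0 < (-1) ^+ b * x)%R].

Lemma sign_setE b : sign_set b = if b then `]-oo, 0%R[%classic else `]0%R, +oo[%classic.
Proof.
case: b; apply/seteqP; split => x /=; rewrite /sign_set/= in_itv/= ?andbT ?expr1 ?expr0;
  by rewrite ?mulN1r ?mul1r ?oppr_gt0.
Qed.

Lemma measurable_sign_set b : measurable (sign_set b).
Proof. by rewrite sign_setE; case: b. Qed.

Lemma sign_setN b : -%R @^-1` sign_set b = sign_set (~~ b).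
Proof.
rewrite /sign_set; apply/seteqP; split => x /=; case: b => /=;
  by rewrite ?expr1 ?expr0 ?mulN1r ?mul1r ?opprK.
Qed.

Lemma normal_pdfN (x : R) : normal_pdf 0 1 (- x) = normal_pdf 0 1 x.
Proof. by rewrite !normal_pdfE ?oner_neq0// /normal_fun !subr0 sqrrN. Qed.

Lemma gaussN (A : set R) : measurable A ->
  pushforward gauss (-%R : _ -> measurableTypeR R) A = gauss A.
Proof.
move=> mA; rewrite /pushforward /=.
have mp : measurable_fun A (@EFin R \o @normal_pdf R 0%R 1%R).
  by apply/measurable_EFinP/measurable_funTS; exact: measurable_normal_pdf.
transitivity (\int[pushforward mu (-%R : _ -> measurableTypeR R)]_(x in A) (normal_pdf 0 1 x)%:E).
  rewrite ge0_integral_pushforward//=; first last.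
    by move=> x _; rewrite lee_fin normal_pdf_ge0.
  by apply: eq_integral => x _ /=; rewrite normal_pdfN.
by apply: eq_measure_integral => B mB _; exact: lebesgue_measureN.
Qed.

Lemma gauss0 : gauss [set 0%R] = 0.
Proof.
have /null_content_dominatesP := @normal_prob_dominates R 0 1.
by apply; [exact: measurable_set1|exact: lebesgue_measure_set1].
Qed.

Lemma gauss_signN b : gauss (sign_set (~~ b)) = gauss (sign_set b).
Proof. by rewrite -(gaussN (measurable_sign_set b)) -sign_setN. Qed.

Lemma gauss_sign b : gauss (sign_set b) = (2^-1)%:E.
Proof.
suff H : gauss (sign_set false) = (2^-1)%:E.
  by case: b => //; rewrite -H -(gauss_signN false).
have : gauss setT = 1 := probability_setT gauss.
have -> : setT = (sign_set false `|` sign_set true) `|` [set 0%R].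
  apply/seteqP; split => // x _.
  have [x0|x0|->] := ltgtP x 0%R; [left; right|left; left|by right].
    by rewrite /sign_set/= expr1 mulN1r oppr_gt0.
  by rewrite /sign_set/= expr0 mul1r.
rewrite measureU//=; first last.
- apply/seteqP; split => // x [[]]; rewrite /sign_set/= => + x0; rewrite x0 mulr0 ltxx//.
- by apply: measurableU; exact: measurable_sign_set.
rewrite measureU//=; try exact: measurable_sign_set; first last.
- apply/seteqP; split => // x []; rewrite /sign_set/= expr1 expr0 mul1r mulN1r oppr_gt0.
  by move=> h1 h2; have := lt_trans h1 h2; rewrite ltxx.
rewrite -/gauss gauss0 adde0 (gauss_signN false).
move=> h; have {h} : gauss (sign_set false) + gauss (sign_set false) = 1 by exact: h.
have : gauss (sign_set false) \is a fin_num.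
  by apply: fin_num_measure; exact: measurable_sign_set.
rewrite -[X in _ -> _ -> X = _]/(gauss (sign_set false)).
case: (gauss (sign_set false)) => // r _; rewrite -EFinD => -[h].
by congr EFin; lra.
Qed.

(** Half of the first absolute moment of a standard Gaussian, kept as an extended real;
    [half_abs_fin] derives its finiteness from type 2. *)
Definition half_abs : \bar R := \int[gauss]_(x in sign_set false) `|x|%R%:E.

Lemma measurable_absE (A : set R) : measurable_fun A (@EFin R \o (@Num.norm _ R)).
Proof. by apply/measurable_EFinP/measurable_funTS; exact: normr_measurable. Qed.

Lemma half_absE b : \int[gauss]_(x in sign_set b) `|x|%R%:E = half_abs.
Proof.
case: b => //; rewrite /half_abs.
transitivity (\int[pushforward gauss (-%R : _ -> measurableTypeR R)]_(x in sign_set false) `|x|%R%:E).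
  rewrite ge0_integral_pushforward//=; first last.
  - exact: measurable_absE.
  - exact: measurable_sign_set.
  by rewrite sign_setN; apply: eq_integral => x _ /=; rewrite normrN.
by apply: eq_measure_integral => B mB _; exact: gaussN.
Qed.

Lemma half_abs_gt0 : 0 < half_abs.
Proof.
rewrite lt_neqAle eq_sym integral_ge0// andbT; apply/eqP => h0.
have : \int[gauss]_(x in sign_set false) `|x%:E| = 0 by exact: h0.
move/(ae_eq_integral_abs gauss (measurable_sign_set false)).
have mid : measurable_fun (sign_set false) (@EFin R).
  by apply/measurable_EFinP; exact: measurable_id.
move=> /(_ mid)[N [mN N0 sub]].
have : gauss (sign_set false) <= gauss N.
  apply: le_measure; rewrite ?inE//; first exact: measurable_sign_set.
  move=> x xs; apply: sub => /= /(_ xs)[] x0.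
  by move: xs; rewrite /sign_set/= x0 mulr0 ltxx.
by rewrite N0 gauss_sign lee_fin leNgt invr_gt0 ltr0n.
Qed.

End gauss_sign.

Section sign_events.
Context {R : realType} {d : measure_display} {T : measurableType d}.
Context {P : probability T R} {n : nat} (g : 'I_n -> {RV P >-> R}).
Hypotheses (ig : independent_RV g) (gg : forall i, standard_gaussian (g i)).
Local Open Scope ereal_scope.

Definition sign_event (s : 'I_n -> bool) : set T :=
  \bigcap_(i in [set: 'I_n]) (g i @^-1` sign_set (s i)).

Let mg i (A : set R) : measurable A -> measurable (g i @^-1` A).
Proof. by move=> mA; rewrite -[X in measurable X]setTI; exact: measurable_funP. Qed.

Lemma measurable_sign_event s : measurable (sign_event s).
Proof.
apply: fin_bigcap_measurable => [|i _]; first exact: finite_finset.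
by apply: mg; exact: measurable_sign_set.
Qed.

Lemma sign_event_disjoint s s' w : sign_event s w -> sign_event s' w -> s =1 s'.
Proof.
move=> ws ws' i; have := ws i I; have := ws' i I; rewrite /sign_set/=.
case: (s i); case: (s' i) => //=; rewrite ?expr0 ?expr1 ?mul1r ?mulN1r ?oppr_gt0 => h1 h2.
  by have := lt_trans h1 h2; rewrite ltxx.
by have := lt_trans h1 h2; rewrite ltxx.
Qed.

(** Off the prescribed signs of the other variables this is 0, a value outside every [sign_set]. On
    [sign_set (s l)] its law is therefore a multiple of [gauss], which reduces the integral over the
    sign event to one dimension. *)
Let restricted s l (w : T) : R :=
  (g l w * \1_(\bigcap_(i in [set i | i != l]) (g i @^-1` sign_set (s i))) w)%R.

Let measurable_restricted s l : measurable_fun setT (restricted s l).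
Proof.
apply: measurable_funM; first exact: measurable_funP.
apply: measurable_indic; apply: fin_bigcap_measurable => [|i _]; first exact: finite_finset.
by apply: mg; exact: measurable_sign_set.
Qed.

Let restricted_preimage s l (A : set R) : A `<=` sign_set (s l) ->
  restricted s l @^-1` A =
  \bigcap_(i in [set: 'I_n]) (g i @^-1` (if i == l then A else sign_set (s i))).
Proof.
move=> As; apply/seteqP; split => w /=.
  rewrite /restricted indicE; have [wG|_] := boolP (_ \in _); last first.
    by rewrite mulr0 => /As; rewrite /sign_set/= mulr0 ltxx.
  rewrite mulr1 => Aw i _ /=; case: eqVneq => [->//|il].
  by move: wG; rewrite inE => /(_ i il).
move=> h; rewrite /restricted indicE mem_set.
  by have := h l I; rewrite /= eqxx mulr1.
by move=> i /= il; have := h i I; rewrite /= (negbTE il).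
Qed.

Let prob_restricted s l (A : set R) : measurable A -> A `<=` sign_set (s l) ->
  P (restricted s l @^-1` A) = (2^-1 ^+ n.-1)%:E * gauss A.
Proof.
move=> mA As; rewrite restricted_preimage// ig; last first.
  by move=> i; case: ifP => // _; exact: measurable_sign_set.
rewrite (bigD1 l)//= eqxx muleC; congr *%E; last exact: (gg l).
rewrite (eq_bigr (fun=> (2^-1)%:E)) => [|i il].
  rewrite -(big_morph EFin EFinM (erefl _)) prodr_const; congr (_ ^+ _)%:E.
  by rewrite cardC1 card_ord.
rewrite (negbTE il); transitivity (@gauss R (sign_set (s i))).
  by apply: (gg i); exact: measurable_sign_set.
exact: gauss_sign.
Qed.

Lemma integral_sign_event s l :
  \int[P]_(w in sign_event s) `|g l w|%R%:E = (2^-1 ^+ n.-1)%:E * half_abs.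
Proof.
have c0 : (0 <= 2^-1 ^+ n.-1 :> R)%R by rewrite exprn_ge0// invr_ge0.
pose c := NngNum c0; pose phi := mfun_of (@measurable_restricted s l).
have Ephi : sign_event s = phi @^-1` sign_set (s l).
  by rewrite restricted_preimage//; apply: eq_bigcapr => i _; case: eqVneq => // ->.
transitivity (\int[pushforward P (phi : T -> measurableTypeR R)]_(x in sign_set (s l)) `|x|%R%:E).
  rewrite ge0_integral_pushforward//=; first last.
  - exact: measurable_absE.
  - exact: measurable_sign_set.
  - exact: measurable_restricted.
  rewrite [in LHS]Ephi; apply: eq_integral => w; rewrite inE -Ephi => ws /=.
  rewrite /restricted indicE mem_set ?mulr1//.
  by move=> i /= _; exact: ws.
transitivity (\int[mscale c gauss]_(x in sign_set (s l)) `|x|%R%:E).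
  apply: eq_measure_integral => [|A mA As]; first exact: measurable_restricted.
  exact: prob_restricted.
rewrite ge0_integral_mscale//=; first last.
- exact: measurable_absE.
- exact: measurable_sign_set.
by rewrite half_absE.
Qed.

End sign_events.

Section integral_mono.
Context d (T : measurableType d) (R : realType) (mu : {measure set T -> \bar R}).
Local Open Scope ereal_scope.

(** The integral of a nonnegative function is a supremum over the simple functions below it, hence
    monotone for arbitrary functions, such as norms and suprema not shown to be measurable. *)
Lemma ge0_le_integral_nonmeasurable (f g : T -> \bar R) :
  (forall x, 0 <= f x) -> (forall x, f x <= g x) ->
  \int[mu]_x f x <= \int[mu]_x g x.
Proof.
move=> f0 fg; have g0 x : 0 <= g x by exact: le_trans (f0 x) (fg x).
rewrite !ge0_integralTE//; apply: ereal_sup_le => _ [h hf <-].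
by apply: imageP => x /=; exact: le_trans (hf x) (fg x).
Qed.

End integral_mono.

Section integrable_minorant.
Context d (T : measurableType d) (R : realType) (mu : {measure set T -> \bar R}).
Local Open Scope ereal_scope.

Lemma integral_minorant (h f : T -> \bar R) :
  (forall x, 0 <= f x) -> (forall x, h x <= f x) ->
  \int[mu]_x h x <= \int[mu]_x f x.
Proof.
move=> f0 hf; rewrite integralE; apply: (@le_trans _ _ (\int[mu]_x h^\+ x)).
  by apply: geeDl; rewrite oppe_le0; apply: integral_ge0 => x _; exact: funeneg_ge0.
apply: ge0_le_integral_nonmeasurable => x; first exact: funepos_ge0.
by rewrite funeposE ge_max hf f0.
Qed.

End integrable_minorant.

Section dual_attain.
Context {R : realType} {E : normedModType R}.

Lemma dual_norm_attain (Z : dual E) (eta : R) : 0 < eta ->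
  exists y : E, `|y| <= 1 /\ `|Z| - eta <= Z y.
Proof.
move=> eta0; have [_ [y y1 <-] hy] := sup_adherent eta0 (dual_norm_has_sup Z).
have [Zy|Zy] := leP 0 (Z y : R).
  by exists y; split => //; rewrite ltW// -(ger0_norm Zy).
exists (- y); split; first by rewrite normrN.
by rewrite linearN/= ltW// -(ltr0_norm Zy).
Qed.

End dual_attain.

(** * Comparison of Gaussian and Rademacher averages in the dual *)

Section rademacher_of_gaussian.
Context {R : realType} {E : normedModType R}.

(* One vector suffices: type 2 bounds [E|g| |x|]. *)
Lemma half_abs_fin (C : R) (x : dual E) : has_type2_with (dual E) C -> x != 0 ->
  (@half_abs R < +oo)%E.
Proof.
move=> tC x0; have [d [T [P [g [ig gg]]]]] := @gaussians_exist R 1.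
have := tC 1%N (fun=> x) d T P g ig gg; rewrite big_ord1 sqrtr_sqr ger0_norm// => h.
have xp : 0 < `|x| by rewrite normr_gt0.
pose s (_ : 'I_1) := false.
have : (\int[P]_(w in sign_event g s) (`|g ord0 w|%R%:E * `|x|%:E) <= (C * `|x|)%:E)%E.
  apply: le_trans h; rewrite unlock integral_mkcond.
  apply: ge0_le_integral_nonmeasurable => w; rewrite patchE; case: ifPn => // _.
  - by rewrite -EFinM big_ord1 normrZ.
  - by rewrite [point](_ : _ = 0%E)// lee_fin.
rewrite ge0_integralZr//=; first last.
- by apply/measurable_EFinP; apply: measurableT_comp => //; apply/measurable_funTS; exact: measurable_funP.
- exact: measurable_sign_event.
rewrite integral_sign_event// expr0 mul1e; case: half_abs => [r| |//]; first by rewrite ltry.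
by rewrite gt0_mulye// leye_eq.
Qed.

(** On the event that the Gaussians have signs [s], their sum is tested at a point [y s] of the unit
    ball that nearly norms [Z s]. Integration replaces every [|g i|] by the same constant, which
    leaves the norms of the signed sums. *)
Lemma rademacher_of_gaussian_ord (C : R) (n : nat) (x : 'I_n -> dual E) :
  has_type2_with (dual E) C -> (@half_abs R < +oo)%E ->
  \sum_(s : {ffun 'I_n -> bool}) `|\sum_i (-1) ^+ s i *: x i|
    <= 2 ^+ n * (C / (2 * fine (@half_abs R)) * l2norm (fun i => `|x i|)).
Proof.
move=> tC afin; case: n x => [|n] x.
  rewrite [leLHS]big1 => [|s _]; last by rewrite big_ord0 normr0.
  by rewrite /l2norm big_ord0 sqrtr0 !mulr0.
have [d [T [P [g [ig gg]]]]] := @gaussians_exist R n.+1.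
have := tC n.+1 x d T P g ig gg; rewrite -/(l2norm _) unlock => type2x.
pose a := fine (@half_abs R).
have aE : half_abs = a%:E :> \bar R by rewrite fineK// ge0_fin_numE// ltW// half_abs_gt0.
have a0 : 0 < a by rewrite -lte_fin -aE half_abs_gt0.
pose q : R := 2^-1 ^+ n * a.
have q0 : 0 < q by rewrite mulr_gt0 ?exprn_gt0.
pose Z (s : {ffun 'I_n.+1 -> bool}) : dual E := \sum_i (-1) ^+ s i *: x i.
apply/ler_addgt0Pr => eta eta0.
pose S : finType := {ffun 'I_n.+1 -> bool}.
have S0 : 0 < eta / 2 ^+ n.+1 by rewrite divr_gt0// exprn_gt0.
have /choice[y yP] : forall s, exists v : E, `|v| <= 1 /\ `|Z s| - eta / 2 ^+ n.+1 <= Z s v.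
  by move=> s; exact: dual_norm_attain.
pose c (p : S * 'I_n.+1) : R := (-1) ^+ p.1 p.2 * x p.2 (y p.1).
pose k (p : S * 'I_n.+1) := (fun w => `|g p.2 w|%R%:E) \_ (sign_event g p.1).
have kE p : (\int[P]_w k p w = q%:E)%E.
  by rewrite -integral_mkcond integral_sign_event// aE -EFinM.
have mabs (p : S * 'I_n.+1) : measurable_fun (sign_event g p.1) (fun w => `|g p.2 w|%R%:E).
  by apply/measurable_EFinP; apply: measurableT_comp => //; apply/measurable_funTS; exact: measurable_funP.
have kint p : P.-integrable setT (k p).
  apply/(integrable_mkcond _ (measurable_sign_event _ _)).
  apply/integrableP; split; first exact: mabs.
  under eq_integral do rewrite /= normr_id.
  by rewrite integral_sign_event// aE -EFinM ltry.
(* A pointwise minorant of the norm of the Gaussian sum, built as a finite combination of integrable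
   functions. *)
pose h w := (\sum_(p : S * 'I_n.+1) (c p)%:E * k p w)%E.
have hint : (\int[P]_w h w = (\sum_p c p * q)%:E)%E.
  rewrite integral_sum//; last by move=> p; exact: integrableZl.
  rewrite -sumEFin; apply: eq_bigr => p _.
  by rewrite integralZl// kE.
have hle w : (h w <= `|\sum_(i < n.+1) g i w *: x i|%R%:E)%E.
  have [[s ws]|ws] := pselect (exists s : S, sign_event g s w); last first.
    rewrite /h big1 => [|p _]; first by rewrite lee_fin.
    rewrite /k patchE memNset ?mule0// => wp; apply: ws; by exists p.1.
  have -> : h w = ((\sum_i g i w *: x i) (y s))%:E.
    rewrite dual_sumE /h -(pair_bigA _ (fun s i => (c (s, i))%:E * k (s, i) w)%E)/=.
    rewrite (bigD1 s)//= [X in (_ + X)%E]big1 => [|s' s's]; last first.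
      apply: big1 => i _; rewrite /k patchE memNset ?mule0// => /= ws'.
      move/eqP: s's; apply; apply/ffunP; exact: (sign_event_disjoint ws' ws).
    rewrite adde0 -sumEFin; apply: eq_bigr => i _.
    rewrite /k patchE mem_set//= -EFinM; congr EFin; rewrite /c/=.
    have := ws i I; rewrite /sign_set/= => gi.
    rewrite mulrAC; congr (_ * _).
    by move: gi; case: (s i) => /=; rewrite ?expr0 ?expr1 ?mul1r ?mulN1r ?oppr_gt0 => gi;
      [rewrite ltr0_norm// opprK|rewrite gtr0_norm].
  rewrite lee_fin (le_trans (ler_norm _))// (le_trans (dual_norm_ge _ _))//.
  by have [y1 _] := yP s; rewrite -[leRHS]mulr1 ler_wpM2l.
have : (\int[P]_w h w <= (C * l2norm (fun i => `|x i|))%:E)%E.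
  by apply: le_trans type2x; exact: integral_minorant.
rewrite hint lee_fin -mulr_suml -(pair_bigA _ (fun s i => c (s, i)))/= => main.
have cZ s : \sum_i c (s, i) = Z s (y s).
  by rewrite /Z dual_sumE.
have low : \sum_s `|Z s| - eta <= \sum_s \sum_i c (s, i).
  have -> : eta = \sum_(s : S) eta / 2 ^+ n.+1.
    rewrite sumr_const card_ffun card_bool card_ord -[RHS]mulr_natl natrX.
    by field; rewrite expf_neq0.
  rewrite -sumrB; apply: ler_sum => s _; rewrite cZ; by case: (yP s).
rewrite -lerBlDr; apply: le_trans low _.
rewrite (_ : 2 ^+ n.+1 * _ = C * l2norm (fun i => `|x i|) / q).
  by rewrite ler_pdivlMr.
by rewrite /q -/a exprS exprVn; field; rewrite expf_neq0// gt_eqF.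
Qed.

Lemma rademacher_of_gaussian (C : R) (x : dual E) :
  has_type2_with (dual E) C -> x != 0 ->
  rademacher_type2 (dual E) (C / (2 * fine (@half_abs R))).
Proof.
move=> tC x0 L X.
have afin := half_abs_fin tC x0.
have := rademacher_of_gaussian_ord (fun i : 'I_#|L| => X (enum_val i)) tC afin.
rewrite /l2norm.
have -> : \sum_(i < #|L|) `|X (enum_val i)| ^+ 2 = \sum_l `|X l| ^+ 2.
  by rewrite [RHS](reindex_onto enum_val enum_rank)//=; [apply: eq_bigl => i; rewrite enum_valK eqxx|move=> l _; rewrite enum_rankK].
apply: le_trans; rewrite le_eqVlt; apply/orP; left; apply/eqP.
pose f (s : {ffun 'I_#|L| -> bool}) : {ffun L -> bool} := [ffun l => s (enum_rank l)].
pose f' (s : {ffun L -> bool}) : {ffun 'I_#|L| -> bool} := [ffun i => s (enum_val i)].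
rewrite (reindex f); last first.
  exists f' => s _; apply/ffunP => i; rewrite !ffunE; first by rewrite enum_valK.
  by rewrite enum_rankK.
apply: eq_bigr => s _; congr Num.norm.
rewrite (reindex_onto enum_val enum_rank)//=; last by move=> l _; rewrite enum_rankK.
rewrite (eq_bigl xpredT) => [|i]; last by rewrite enum_valK eqxx.
by apply: eq_bigr => i _; rewrite ffunE enum_valK.
Qed.

End rademacher_of_gaussian.

(** * The average over the signs *)

Section bernoulli_average.
Context {R : realType} {d : measure_display} {T : measurableType d}.
Context {P : probability T R} {m : nat} (eps : 'I_m -> {RV P >-> R}).
Hypothesis ieps : independent_RV eps.
Hypothesis beps : forall j, symmetric_bernoulli (eps j).
Local Open Scope ereal_scope.

Let A (s : {ffun 'I_m -> bool}) : set T :=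
  \bigcap_(j in [set: 'I_m]) (eps j @^-1` [set (-1) ^+ s j]%R).

Let mA s : measurable (A s).
Proof.
apply: fin_bigcap_measurable => [|i _]; first exact: finite_finset.
by rewrite -[X in measurable X]setTI; apply: measurable_funP => //; exact: measurable_set1.
Qed.

Let PA s : P (A s) = (2^-1 ^+ m)%:E.
Proof.
rewrite ieps => [|j]; last exact: measurable_set1.
rewrite (eq_bigr (fun=> (2^-1)%:E)) => [|j _].
  by rewrite -(big_morph EFin EFinM (erefl _)) prodr_const card_ord.
by have [h1 h2] := beps j; case: (s j); rewrite ?expr1 ?expr0.
Qed.

Let A_uniq s s' w : A s w -> A s' w -> s = s'.
Proof.
move=> h h'; apply/ffunP => j; have := h j I; rewrite /= (h' j I : eps j w = _).
case: (s j); case: (s' j) => //=; rewrite ?expr0 ?expr1 => /eqP.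
  by rewrite -subr_eq0 opprK (_ : (1 + 1 = 2%:R :> R)%R)// pnatr_eq0.
by rewrite eq_sym -subr_eq0 opprK (_ : (1 + 1 = 2%:R :> R)%R)// pnatr_eq0.
Qed.

Let exceptional : set T := ~` \bigcup_(s in [set: {ffun 'I_m -> bool}]) A s.

Let m_bigcup : measurable (\bigcup_(s in [set: {ffun 'I_m -> bool}]) A s).
Proof. by apply: fin_bigcup_measurable => // ; exact: finite_finset. Qed.

Let P_exceptional : P exceptional = 0.
Proof.
rewrite /exceptional probability_setC//.
rewrite measure_fin_bigcup//; last 2 first.
- exact: finite_finset.
- by move=> s s' _ _ [w [h h']]; exact: A_uniq h h'.
rewrite (_ : [set: {ffun 'I_m -> bool}] = [set` index_enum {ffun 'I_m -> bool}]); last first.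
  by apply/seteqP; split => s //= _; exact: mem_index_enum.
rewrite -fsbig_seq ?index_enum_uniq// (eq_bigr (fun=> (2^-1 ^+ m)%:E)) => [|s _]; last exact: PA.
rewrite sumEFin sumr_const card_ffun card_bool card_ord -EFinB; congr EFin.
rewrite -[X in (1 - X)%R]mulr_natl natrX -exprMn mulfV ?pnatr_eq0//.
by rewrite expr1n subrr.
Qed.

(** Almost surely the variables form one of the [2^m] sign patterns, each of probability [2^-m]. *)
Lemma bernoulli_average (G : ('I_m -> R) -> R) : (forall e, (0 <= G e)%R) ->
  'E_P[fun w => G (fun j => eps j w)] <=
  (2^-1 ^+ m * \sum_(s : {ffun 'I_m -> bool}) G (fun j => ((-1) ^+ s j)%R))%:E.
Proof.
move=> G0; rewrite unlock.
(* A measurable majorant: the value of [G] on each sign pattern, and [+oo] on the null set where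
   some variable is not a sign. *)
pose H w := \sum_(s : {ffun 'I_m -> bool}) (cst (G (fun j => ((-1) ^+ s j)%R))%:E \_ (A s)) w
  + (cst +oo \_ exceptional) w.
have mE : measurable exceptional by exact: measurableC.
have H1 (s : {ffun 'I_m -> bool}) w : 0 <= (cst (G (fun j => ((-1) ^+ s j)%R))%:E \_ (A s)) w.
  by rewrite patchE; case: ifP => // _; rewrite lee_fin.
have H2 w : 0 <= (cst +oo \_ exceptional) w :> \bar R.
  by rewrite patchE; case: ifP => _; [exact: leey|exact: lexx].
have m1 (s : {ffun 'I_m -> bool}) :
    measurable_fun setT (cst (G (fun j => ((-1) ^+ s j)%R))%:E \_ (A s)).
  by apply/(measurable_restrictT _ (mA s)); exact: measurable_cst.
have m2 : measurable_fun setT (cst +oo \_ exceptional : T -> \bar R).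
  by apply/(measurable_restrictT _ mE); exact: measurable_cst.
apply: (@le_trans _ _ (\int[P]_w H w)).
  apply: ge0_le_integral_nonmeasurable => w; first by rewrite lee_fin.
  have [[s _ ws]|nw] := pselect ((\bigcup_(s in [set: {ffun 'I_m -> bool}]) A s) w).
    rewrite /H (bigD1 s)//= [X in X + _ + _]patchE mem_set//=.
    rewrite (_ : (fun j => eps j w) = (fun j => ((-1) ^+ s j)%R)); last first.
      by apply/funext => j; exact: ws.
    by rewrite -addeA leeDl// adde_ge0//; apply: sume_ge0 => s' _; exact: H1.
  rewrite /H [X in _ + X]patchE mem_set//= addey ?leey// gt_eqF//.
  by apply: (@lt_le_trans _ _ 0) => //; apply: sume_ge0 => s' _; exact: H1.
rewrite /H ge0_integralD//=; first last.
- exact: emeasurable_sum.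
- by move=> w _; apply: sume_ge0 => s' _; exact: H1.
rewrite ge0_integral_sum//.
rewrite -[X in _ + X]integral_mkcond.
rewrite [X in _ + X](integral_abs_eq0 mE (measurable_cst (+oo : \bar R)) P_exceptional) adde0.
rewrite (eq_bigr (fun s : {ffun 'I_m -> bool} => (G (fun j => ((-1) ^+ s j)%R) * 2^-1 ^+ m)%:E)) => [|s _].
  by rewrite sumEFin -mulr_suml mulrC.
rewrite -integral_mkcond integral_cst// EFinM; congr *%E; exact: PA.
Qed.

End bernoulli_average.

(** * Lower bounds for the constants in nonzero spaces *)

Section nontrivial.
Context {R : realType} {E : normedModType R}.

Lemma rademacher_const_ge1 (tau : R) (x : dual E) :
  rademacher_type2 (dual E) tau -> x != 0 -> 1 <= tau.
Proof.
move=> Ftau x0; have xp : 0 < `|x| by rewrite normr_gt0.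
have := Ftau 'I_1 (fun=> x).
rewrite (eq_bigr (fun=> `|x|)) => [|s _]; last first.
  by rewrite big_ord1 normrZ normrX normrN1 expr1n mul1r.
rewrite sumr_const card_ffun card_bool card_ord -[leLHS]mulr_natl natrX.
rewrite /l2norm big_ord1 sqrtr_sqr ger0_norm// ler_pM2l ?exprn_gt0//.
by rewrite ler_pMl.
Qed.

(** The convexity inequality is tested at [v] and [- v]. *)
Lemma convexity_const_ge1 (lambda : R) (v : E) :
  0 < lambda -> convex_power_type2 E lambda -> v != 0 -> 1 <= lambda.
Proof.
move=> l0 cvx v0; have vp : 0 < `|v| by rewrite normr_gt0.
have := cvx v (- v); rewrite subrr scaler0 normr0 expr0n/= add0r normrN opprK.
rewrite -mulr2n -(scaler_nat 2 v) scalerA mulVf ?pnatr_eq0// scale1r => h.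
have : lambda ^- 2 * `|v| ^+ 2 <= 1 * `|v| ^+ 2 by lra.
rewrite ler_pM2r ?exprn_gt0// -exprVn expr_le1// ?invr_ge0 ?(ltW l0)//.
by rewrite invf_le1.
Qed.

End nontrivial.

(** * The suprema over the unit ball *)

Section random_squares.
Context {R : realType} {E : normedModType R} {m : nat} (X : 'I_m -> dual E).

Definition signed_squares_sup (e : 'I_m -> R) : R :=
  sup [set `|\sum_(j < m) e j * `|X j y : R| ^+ 2| | y in unit_ball E].

Definition max_norm : R := \big[Num.max/0]_(j < m) `|X j|.

Definition weak_l2_sup : R :=
  sup [set Num.sqrt (\sum_(j < m) `|X j y : R| ^+ 2) | y in unit_ball E].

Lemma le_max_norm j : `|X j| <= max_norm.
Proof. exact: le_bigmax. Qed.

Lemma signed_squares_has_sup e :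
  has_sup [set `|\sum_(j < m) e j * `|X j y : R| ^+ 2| | y in unit_ball E].
Proof.
split; first by eexists; exists 0 => //; rewrite /unit_ball/= normr0.
exists (\sum_j `|e j| * `|X j| ^+ 2) => _ [y y1 <-].
rewrite (le_trans (ler_norm_sum _ _ _))// ler_sum// => j _.
rewrite normrM ler_wpM2l// normrX normr_id lerXn2r ?nnegrE//.
exact: dual_norm_ub.
Qed.

Lemma signed_squares_sup_ge0 e : 0 <= signed_squares_sup e.
Proof.
apply: le_trans (_ : `|\sum_(j < m) e j * `|X j 0 : R| ^+ 2| <= _) => //.
apply: sup_upper_bound; first exact: signed_squares_has_sup.
by exists 0 => //; rewrite /unit_ball/= normr0.
Qed.

Lemma weak_l2_has_sup :
  has_sup [set Num.sqrt (\sum_(j < m) `|X j y : R| ^+ 2) | y in unit_ball E].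
Proof.
split; first by eexists; exists 0 => //; rewrite /unit_ball/= normr0.
exists (Num.sqrt (\sum_j `|X j| ^+ 2)) => _ [y y1 <-].
rewrite ler_wsqrtr// ler_sum// => j _; rewrite lerXn2r ?nnegrE//.
exact: dual_norm_ub.
Qed.

Lemma l2norm_evals_le y : `|y| <= 1 -> l2norm (evals X y) <= weak_l2_sup.
Proof.
move=> y1; apply: sup_upper_bound; first exact: weak_l2_has_sup.
exists y => //; rewrite /l2norm; congr Num.sqrt; apply: eq_bigr => j _.
by rewrite real_normK ?num_real.
Qed.

(** Choosing for each sign pattern a point that attains the supremum up to [eta] reduces the claim
    to [finite_bound]. *)
Lemma average_signed_squares_sup (tau lambda : R) :
  (2 <= m)%N -> 1 <= tau -> 0 < max_norm -> 0 < weak_l2_sup -> 1 <= lambda ->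
  convex_power_type2 E lambda -> rademacher_type2 (dual E) tau ->
  2^-1 ^+ m * \sum_(s : {ffun 'I_m -> bool}) signed_squares_sup (fun j => (-1) ^+ s j)
  <= chain_const R * (tau * max_norm * weak_l2_sup * lambda ^+ 2 * Num.sqrt (ln m%:R)).
Proof.
move=> m2 tau1 M0 A0 lambda1 cvx Etau; apply/ler_addgt0Pr => eta eta0.
have /choice[y yP] : forall s : {ffun 'I_m -> bool}, exists v : E, `|v| <= 1 /\
    signed_squares_sup (fun j => (-1) ^+ s j) <=
    `|rademacher_sum (fun j => evals X v j ^+ 2) s| + eta.
  move=> s; have [_ [v v1 <-] hv] := sup_adherent eta0
    (signed_squares_has_sup (fun j => (-1) ^+ s j)).
  exists v; split => //; rewrite -lerBlDr ltW//; apply: lt_le_trans hv _.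
  rewrite le_eqVlt; apply/orP; left; apply/eqP; congr Num.norm.
  by apply: eq_bigr => j _; rewrite real_normK ?num_real.
have fb := @finite_bound R E m X tau max_norm weak_l2_sup lambda y m2 tau1 M0 A0
  lambda1 cvx Etau le_max_norm l2norm_evals_le (fun s => (yP s).1).
rewrite exprVn ler_pdivrMl ?exprn_gt0//.
apply: le_trans (ler_sum _ (fun s _ => (yP s).2)) _.
rewrite big_split/= sumr_const card_ffun card_bool card_ord -[X in _ + X]mulr_natl natrX.
by rewrite mulrDr lerD2r.
Qed.

End random_squares.

(** * Assembly of the estimate *)

Theorem theorem1 (R : realType) :
  exists C : R, 0 < C /\
  forall (lambda : R) (E : completeNormedModType R),
    0 < lambda -> convex_power_type2 E lambda ->
  forall (m : nat) (X : 'I_m -> dual E), (2 <= m)%N ->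
  forall (d : measure_display) (T : measurableType d) (P : probability T R)
    (eps : 'I_m -> {RV P >-> R}),
    independent_RV eps -> (forall j, symmetric_bernoulli (eps j)) ->
  ('E_P[fun w =>
      sup [set `|\sum_(j < m) eps j w * `|X j y : R| ^+ 2| | y in unit_ball E]%R]
   <= (C * lambda ^+ 4)%:E * type2_constant (dual E)
      * (Num.sqrt (ln m%:R) * \big[Num.max/0]_(j < m) `|X j|
         * sup [set Num.sqrt (\sum_(j < m) `|X j y : R| ^+ 2)
               | y in unit_ball E])%:E)%E.
Proof.
(* If [half_abs] were infinite, [fine] would give [a = 0]. The [+ 1] in the constant keeps it
   positive in every case. *)
pose a := 2 * fine (@half_abs R).
have a0 : 0 <= a by rewrite mulr_ge0// fine_ge0// ltW// half_abs_gt0.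
exists (chain_const R * (a^-1 + 1)); split.
  by rewrite mulr_gt0 ?chain_const_gt0// ltr_wpDl// invr_ge0.
move=> lambda E lambda0 cvx m X m2 d T P eps ieps beps.
rewrite -/(max_norm X) -/(weak_l2_sup X).
have := bernoulli_average ieps beps (signed_squares_sup_ge0 X).
move/le_trans; apply; set avg := _ * _.
have T20 : (0 <= type2_constant (dual E))%E.
  by apply: le_ereal_inf_tmp => _ [c [c0 _] <-]; rewrite lee_fin.
have C0 : 0 <= chain_const R * (a^-1 + 1) by rewrite mulr_ge0 ?(ltW (chain_const_gt0 R))// addr_ge0// invr_ge0.
have lam4 : 0 <= lambda ^+ 4 by rewrite exprn_ge0// ltW.
have sl0 : 0 <= Num.sqrt (ln m%:R) :> R by exact: sqrtr_ge0.
have M0 : 0 <= max_norm X.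
  by apply: le_trans (le_max_norm X (Ordinal (ltnW m2))).
have A0 : 0 <= weak_l2_sup X.
  apply: le_trans (l2norm_evals_le X (y := 0) _); first exact: l2norm_ge0.
  by rewrite normr0.
(* If all vectors vanish, so does the average. Otherwise some [X j] is nonzero, and so is [E], which
   yields the lower bounds by 1 for [lambda] and the type 2 constant. *)
have [X0|] := pselect (forall j, X j = 0).
  rewrite (_ : avg = 0).
    apply: mule_ge0; last by rewrite lee_fin !mulr_ge0.
    by apply: mule_ge0 => //; rewrite lee_fin mulr_ge0.
  rewrite /avg [X in _ * X]big1 ?mulr0// => s _; apply/eqP; rewrite eq_le signed_squares_sup_ge0 andbT.
  apply: ge_sup; first by case: (signed_squares_has_sup X (fun j => (-1) ^+ s j)).
  move=> _ [y _ <-]; rewrite big1 ?normr0// => j _.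
  by rewrite X0 normr0 expr0n mulr0.
move=> /existsNP[j /eqP Xj0].
have Mp : 0 < max_norm X by apply: lt_le_trans (le_max_norm X j); rewrite normr_gt0.
have [v v1 Xjv] : exists2 v : E, `|v| <= 1 & X j v != 0 :> R.
  have Xp : 0 < `|X j| / 2 by rewrite divr_gt0// normr_gt0.
  have [v [v1 hv]] := dual_norm_attain (X j) Xp.
  by exists v => //; rewrite gt_eqF//; apply: lt_le_trans hv; lra.
have v0 : v != 0 by apply: contra_neq Xjv => ->; rewrite linear0.
have Ap : 0 < weak_l2_sup X.
  apply: lt_le_trans (l2norm_evals_le X v1); rewrite lt_neqAle l2norm_ge0 andbT eq_sym.
  by apply/eqP => /l2norm_eq0/(_ j) /eqP; rewrite (negbTE Xjv).
have lambda1 := convexity_const_ge1 lambda0 cvx v0.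
have slp : 0 < Num.sqrt (ln m%:R) :> R by rewrite sqrtr_gt0 ln_gt0// ltr1n.
pose B := Num.sqrt (ln m%:R) * max_norm X * weak_l2_sup X.
have B0 : 0 < B by rewrite !mulr_gt0.
pose q := chain_const R * (a^-1 + 1) * lambda ^+ 4 * B.
have q0 : 0 < q.
  by rewrite !mulr_gt0 ?exprn_gt0 ?chain_const_gt0// ltr_wpDl// invr_ge0.
(* Dividing by [q > 0] isolates the infimum, so the bound is checked for each admissible constant
   [c]; an infinite type 2 constant is covered. *)
rewrite -/B muleAC -EFinM -/q -lee_pdivrMl//.
apply: le_ereal_inf_tmp => _ [c [c0 tc] <-].
rewrite -EFinM lee_fin ler_pdivrMl//.
have tau2 := rademacher_of_gaussian tc Xj0.
have tau1 := rademacher_const_ge1 tau2 Xj0.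
apply: le_trans (average_signed_squares_sup m2 tau1 Mp Ap lambda1 cvx tau2) _.
rewrite -/a /q /B; set k := chain_const R; set S := Num.sqrt _.
(* The estimate obtained carries [lambda ^+ 2], which is at most [lambda ^+ 4] because
   [lambda >= 1]. *)
rewrite [leLHS](_ : _ = (k * S * max_norm X * weak_l2_sup X * c) * (a^-1 * lambda ^+ 2)); last by ring.
rewrite [leRHS](_ : _ = (k * S * max_norm X * weak_l2_sup X * c) * ((a^-1 + 1) * lambda ^+ 4)); last by ring.
apply: ler_wpM2l; first by rewrite !mulr_ge0// ltW// chain_const_gt0.
apply: ler_pM => //; rewrite ?invr_ge0 ?exprn_ge0 ?(ltW lambda0) ?lerDl//.
exact: ler_weXn2l.
Qed.
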